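(* Let $\{f_n\}_{n=1}^\infty$ be a sequence of Lebesgue measurable functions on $[0,1]$ containing a subsequence $\{f_{n_k}\}$ such that: 1) $|f_{n_k}(x)|\le D$ for all $k$ and $x\in[0,1]$; 2) $f_{n_k}\to0$ weakly in $L_2[0,1]$; and 3') for every measurable $F\subset[0,1]$ with $|F|>0$, $\liminf_{k\to\infty}\int_F f_{n_k}^2(x)\,dx>0$. Then there exists a subsystem $\{\varphi_i\}_{i=1}^\infty\subset\{f_n\}$ such that for every segment $I\subset[0,1]$ with $|I|>0$ there is $k_0=k_0(I)\in\mathbb N$ for which $\{\varphi_i\chi_I\}_{i=k_0}^\infty$ (functions on $[0,1]$ with Lebesgue measure) is equivalent in distribution to the Rademacher system.
   Context: $|\cdot|$ denotes Lebesgue measure, $\chi_I$ the indicator of $I$. The Rademacher system is $r_n(x)=\operatorname{sign}\sin(2^{n-1}\pi x)$ on $[0,1]$. Equivalence in distribution of $\{f_n\}$ and $\{g_n\}$: there is $C>0$ such that for all $m$, real $a_1,\dots,a_m$ and $z>0$, $C^{-1}\mathbb P\{|\sum_{n=1}^m a_nf_n|>Cz\}\le\mathbb P'\{|\sum_{n=1}^m a_ng_n|>z\}\le C\,\mathbb P\{|\sum_{n=1}^m a_nf_n|>C^{-1}z\}$. *)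

(* Defs.v *)
(* Lebesgue measure = the COMPLETED
   Lebesgue measure on R (so that "measurable" means Lebesgue measurable). *)
From mathcomp Require Import all_boot all_order all_algebra.
From mathcomp Require Import all_classical all_reals all_analysis.
Import Order.TTheory GRing.Theory Num.Theory.
Unset Printing Implicit Defensive.
Local Open Scope ring_scope.
Local Open Scope classical_set_scope.

(* The real line equipped with the Lebesgue (completed) sigma-algebra. *)
Definition Leb (R : realType) : Type :=
  ltac:(let t := type of (@completed_lebesgue_measure R) in
        match t with set ?T -> _ => exact T end).

Definition leb {R : realType} : set (Leb R) -> \bar R :=
  @completed_lebesgue_measure R.

Definition seg {R : realType} (a b : R) : set (Leb R) := (`[a, b] : set R).
Definition I01 (R : realType) : set (Leb R) := seg 0 1.

(* Rademacher functions r_n(x) = sign sin(2^(n-1) pi x), n >= 1 *)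
Definition rademacher (R : realType) (n : nat) (x : Leb R) : R :=
  Num.sg (sin (2 ^+ n.-1 * pi * (x : R))).

Definition weakL2_to0 {R : realType} (u : nat -> Leb R -> R) : Prop :=
  forall g : Leb R -> R,
    measurable_fun (I01 R) g ->
    (\int[@leb R]_(x in I01 R) ((g x) ^+ 2)%:E < +oo)%E ->
    (fun k => Rintegral (@leb R) (I01 R) (fun x => u k x * g x)) @ \oo --> 0.

(* sequences {f_n}_{n>=1}, {g_n}_{n>=1} (indexed here from 0) of functions on
   ([0,1], Lebesgue) are equivalent in distribution *)
Definition equiv_distr {R : realType} (f g : nat -> Leb R -> R) : Prop :=
  exists C : R, 0 < C /\
    forall (m : nat) (a : nat -> R) (z : R), 0 < z ->
      ((C^-1)%:E * leb (I01 R `&`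
          [set x | (C * z < `| \sum_(i < m) a i * f i x |)%R]) <=
       leb (I01 R `&` [set x | (z < `| \sum_(i < m) a i * g i x |)%R]))%E /\
      (leb (I01 R `&` [set x | (z < `| \sum_(i < m) a i * g i x |)%R]) <=
       C%:E * leb (I01 R `&`
          [set x | (C^-1 * z < `| \sum_(i < m) a i * f i x |)%R]))%E.

(* Main.v *)
Require Import Defs.
From mathcomp Require Import all_boot all_order all_algebra.
From mathcomp Require Import all_classical all_reals all_analysis.
From mathcomp Require Import measurable_realfun ring lra.
Import Order.TTheory GRing.Theory Num.Theory.
Import numFieldNormedType.Exports.
Local Open Scope ring_scope.
Local Open Scope classical_set_scope.

(** Both tail estimates rest on Riesz products. If [psi_i] is the subsequence
    divided by its bound and [e] ranges over signs, then
    [K(x, e) = \prod_i (1 + e_i psi_i(x))] is nonnegative, has mean 1 in [e], and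
    integrates [\sum_i a_i e_i] in [e] to [\sum_i a_i psi_i(x)]. When each
    [psi_n] is chosen late enough, its means against the finitely many products
    formed before are summably small, so that the means of [K(., e)] in [x] are
    bounded by 2; Jensen's inequality then dominates the excess
    [(|\sum_i a_i psi_i| - z)+] by that of the sign sum.

    Conversely, on a rational segment [J], the mean in [x] of
    [\sum_i a_i psi_i(x) K(x, e)] is close to [c \sum_i a_i e_i], where [c > 0] is
    the limit of the means of [psi_n^2] over [J]. For this, [psi_n^2] must have
    limits against all earlier products. Those limits are taken along a
    nonprincipal ultrafilter and define a functional [L]; [L(g psi_n)] tends to 0
    because [L] is bounded for the [L2] norm and [psi_n] tends weakly to 0.

    Excesses are turned back into tails by Kahane's inequality
    [P(|S| > s + t) <= 4 P(|S| > s) P(|S| > t)] for sign sums [S]. *)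

Set Implicit Arguments.
Unset Strict Implicit.

(** * Sums of random signs *)

Section signs.
Variable R : archiRealFieldType.
Implicit Types (a e u : nat -> R) (b c s t z : R) (m n : nat).

Definition scons (x : R) e : nat -> R := fun i => if i is j.+1 then e j else x.

(** The expectation of [G] over [m] independent fair signs. Recursion on the first sign replaces a
    probability space; coordinates from [m] on are set to 1. *)
Fixpoint av m (G : (nat -> R) -> R) : R :=
  if m is m'.+1 then
    (av m' (fun e => G (scons 1 e)) + av m' (fun e => G (scons (-1) e))) / 2
  else G (fun=> 1).

Definition is_sign e := forall i, e i = 1 \/ e i = -1.

Lemma is_sign_scons e x : x = 1 \/ x = -1 -> is_sign e -> is_sign (scons x e).
Proof. by move=> hx he [|i] /=. Qed.

Lemma le_av m (G H : (nat -> R) -> R) :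
  (forall e, is_sign e -> G e <= H e) -> av m G <= av m H.
Proof.
elim: m G H => [|m IH] G H GH /=; first by apply: GH => i; left.
apply: ler_wpM2r; first by rewrite invr_ge0.
by apply: lerD; apply: IH => e he; apply: GH; apply: is_sign_scons; auto.
Qed.

Lemma eq_av m (G H : (nat -> R) -> R) :
  (forall e, is_sign e -> G e = H e) -> av m G = av m H.
Proof. by move=> GH; apply/eqP; rewrite eq_le !le_av // => e he; rewrite GH. Qed.

Lemma avD m (G H : (nat -> R) -> R) :
  av m (fun e => G e + H e) = av m G + av m H.
Proof. by elim: m G H => [|m IH] G H //=; rewrite !IH; field. Qed.

Lemma avZ m c (G : (nat -> R) -> R) : av m (fun e => c * G e) = c * av m G.
Proof. by elim: m G => [|m IH] G //=; rewrite !IH; field. Qed.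

Lemma av_cst m c : av m (fun=> c) = c.
Proof. by elim: m => [|m IH] //=; rewrite !IH; field. Qed.

Lemma av_sum m n (G : nat -> (nat -> R) -> R) :
  av m (fun e => \sum_(k < n) G k e) = \sum_(k < n) av m (G k).
Proof.
elim: n => [|n IH].
  by rewrite big_ord0 -[RHS](av_cst m); apply: eq_av => e _; rewrite big_ord0.
rewrite big_ord_recr /= -IH -avD; apply: eq_av => e _.
by rewrite big_ord_recr.
Qed.

(** The shift [b] carries the signs already fixed. Averaging [1 + x * u 0] times an affine function
    of [x] over [x = 1, -1] turns [x] into [u 0]. *)
Lemma av_riesz m a u b :
  av m (fun e => (b + \sum_(i < m) a i * e i) * \prod_(i < m) (1 + e i * u i)) =
  b + \sum_(i < m) a i * u i.
Proof.
elim: m a u b => [|m IH] a u b /=; first by rewrite !big_ord0 mulr1.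
have step x : av m (fun e => (b + \sum_(i < m.+1) a i * scons x e i) *
      \prod_(i < m.+1) (1 + scons x e i * u i)) =
    (1 + x * u 0%N) * (b + a 0%N * x + \sum_(i < m) a i.+1 * u i.+1).
  rewrite -(IH (fun i => a i.+1) (fun i => u i.+1)) -avZ.
  by apply: eq_av => e _; rewrite !big_ord_recl /=; ring.
by rewrite !step big_ord_recl /=; field.
Qed.

Lemma av_riesz1 m u : av m (fun e => \prod_(i < m) (1 + e i * u i)) = 1.
Proof.
transitivity (1 + \sum_(i < m) 0 * u i); last first.
  by rewrite big1 ?addr0 // => i _; rewrite mul0r.
rewrite -(av_riesz m (fun=> 0)); apply: eq_av => e _.
by rewrite [X in 1 + X]big1 ?addr0 ?mul1r // => i _; rewrite mul0r.
Qed.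

Lemma riesz_ge0 m u e : is_sign e -> (forall i, (i < m)%N -> `|u i| <= 1) ->
  0 <= \prod_(i < m) (1 + e i * u i).
Proof.
move=> he hu; apply: prodr_ge0 => i _; have := hu i (ltn_ord i).
by rewrite ler_norml => /andP[]; case: (he i) => ->; lra.
Qed.

(* Jensen's inequality for the probability with density the Riesz kernel. *)
Lemma jensen_riesz m a u z : (forall i, (i < m)%N -> `|u i| <= 1) ->
  Num.max (`|\sum_(i < m) a i * u i| - z) 0 <=
  av m (fun e => Num.max (`|\sum_(i < m) a i * e i| - z) 0 *
                 \prod_(i < m) (1 + e i * u i)).
Proof.
move=> hu; rewrite ge_max; apply/andP; split; last first.
  rewrite -[leLHS](av_cst m); apply: le_av => e he.
  by rewrite mulr_ge0 ?riesz_ge0 // le_max lexx orbT.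
(* [|S| - z] is the larger of the affine expressions [x * S - z] with [x = 1, -1], and [av_riesz]
   computes each of them exactly. *)
have bound x : x = 1 \/ x = -1 -> x * (\sum_(i < m) a i * u i) - z <=
  av m (fun e => Num.max (`|\sum_(i < m) a i * e i| - z) 0 *
                 \prod_(i < m) (1 + e i * u i)).
  move=> hx.
  have -> : x * (\sum_(i < m) a i * u i) - z = - z + \sum_(i < m) (x * a i) * u i.
    by rewrite addrC mulr_sumr; congr (_ + _); apply: eq_bigr => i _; ring.
  rewrite -(av_riesz m (fun i => x * a i)); apply: le_av => e he.
  apply: ler_wpM2r; first exact: riesz_ge0.
  rewrite le_max; apply/orP; left; rewrite addrC lerD2r.
  rewrite (eq_bigr (fun i : 'I_m => x * (a i * e i))); last by move=> i _; ring.
  rewrite -mulr_sumr; apply: le_trans (ler_norm _) _; rewrite normrM.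
  by case: hx => ->; rewrite ?normrN normr1 mul1r.
by case: (ger0P (\sum_(i < m) a i * u i)) => _;
  [rewrite -[X in X - z]mul1r | rewrite -mulN1r]; apply: bound; auto.
Qed.

(** * Tails of sign sums and Kahane's inequality *)

Definition tail m a b t : R :=
  av m (fun e => (t < `|b + \sum_(i < m) a i * e i|)%R%:R).

Lemma tailS m a b t : tail m.+1 a b t =
  (tail m (fun i => a i.+1) (b + a 0%N) t +
   tail m (fun i => a i.+1) (b - a 0%N) t) / 2.
Proof.
rewrite /tail /=; congr ((_ + _) / _); apply: eq_av => e _;
  by rewrite big_ord_recl /= ?mulr1 ?mulrN1 addrA.
Qed.

Lemma tail0 a b t : tail 0 a b t = (t < `|b|)%R%:R.
Proof. by rewrite /tail /= big_ord0 addr0. Qed.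

Lemma tail_ge0 m a b t : 0 <= tail m a b t.
Proof. by rewrite -(av_cst m 0); apply: le_av => e _; rewrite ler0n. Qed.

Lemma tail_le1 m a b t : tail m a b t <= 1.
Proof. by rewrite -(av_cst m 1); apply: le_av => e _; case: (_ < _). Qed.

Lemma le_tail m a b s t : s <= t -> tail m a b t <= tail m a b s.
Proof.
move=> st; apply: le_av => e _; rewrite ler_nat.
by case: (ltP t) => // /(le_lt_trans st) ->.
Qed.

Lemma tailN m a b t : tail m a (- b) t = tail m a b t.
Proof.
elim: m a b => [|m IH] a b; first by rewrite !tail0 normrN.
rewrite !tailS; have -> : - b + a 0%N = - (b - a 0%N) by ring.
have -> : - b - a 0%N = - (b + a 0%N) by ring.
by rewrite !IH addrC.
Qed.

(** For one and the same choice of signs the two sums differ by [b - b'], so they cannot both lie in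
    [[-s, s]]. *)
Lemma tail_sep m a b b' s :
  s + s < `|b - b'| -> 1 <= tail m a b s + tail m a b' s.
Proof.
elim: m a b b' => [|m IH] a b b' h.
  rewrite !tail0; have := ler_normB b b'.
  by case: (ltP s `|b|) => h1; case: (ltP s `|b'|) => h2 /=; lra.
rewrite !tailS; set a' := fun i => _.
have := IH a' (b + a 0%N) (b' + a 0%N); have := IH a' (b - a 0%N) (b' - a 0%N).
have -> : b - a 0%N - (b' - a 0%N) = b - b' by ring.
have -> : b + a 0%N - (b' + a 0%N) = b - b' by ring.
by move=> /(_ h) h1 /(_ h) h2; lra.
Qed.

Lemma tail_gt m a b s : s < `|b| -> 1 <= 2 * tail m a b s.
Proof.
move=> h; have := @tail_sep m a b (- b) s.
rewrite tailN (_ : b - - b = b *+ 2); last by ring.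
by rewrite normrMn => H; have := H (ltac:(lra)); lra.
Qed.

(** With all signs but the [j]-th fixed, the two values of the sum differ by [2 * a j], and one of
    them leaves [[-s, s]]. A small tail thus excludes large coefficients. *)
Lemma tail_coef m a b s j : (j < m)%N -> s < `|a j| -> 1 <= 2 * tail m a b s.
Proof.
elim: m a b j => [|m IH] a b [|j] // jm h; rewrite tailS.
  have := @tail_sep m (fun i => a i.+1) (b + a 0%N) (b - a 0%N) s.
  have -> : b + a 0%N - (b - a 0%N) = a 0%N *+ 2 by ring.
  by rewrite normrMn => H; have := H (ltac:(lra)); lra.
have h1 := IH (fun i => a i.+1) (b + a 0%N) j jm h.
by have h2 := IH (fun i => a i.+1) (b - a 0%N) j jm h; lra.
Qed.

Lemma tail_center m a b t : tail m a 0 t <= 2 * tail m a b t.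
Proof.
(* The center [c] is there for the induction: [2 * c] is the sum of [b + c] and [- b + c], so one of
   these is at least [|c|] in absolute value. *)
suff H c : tail m a c t <= tail m a (b + c) t + tail m a (- b + c) t.
  by have := H 0; rewrite !addr0 tailN; lra.
elim: m a c => [|m IH] a c.
  rewrite !tail0; have : `|c *+ 2| <= `|b + c| + `|- b + c|.
    by rewrite -[c *+ 2](_ : b + c + (- b + c) = _) ?ler_normD //; ring.
  rewrite normrMn.
  by case: (ltP t `|c|) => h; case: (ltP t `|b + c|) => h1;
    case: (ltP t `|- b + c|) => h2 /=; lra.
rewrite !tailS -!addrA; set a' := fun i => _.
by have := IH a' (c + a 0%N); have := IH a' (c - a 0%N); lra.
Qed.

Lemma tail_shift m a b c s t :
  `|b| <= s -> tail m a (b + c) (s + t) <= tail m a c t.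
Proof.
move=> h; apply: le_av => e _; rewrite ler_nat.
case: (ltP (s + t)) => // h1; rewrite lt_neqAle.
suff : t < `|c + \sum_(i < m) a i * e i| by rewrite lt_neqAle => ->.
by have := ler_normD b (c + \sum_(i < m) a i * e i); rewrite addrA; lra.
Qed.

Lemma tail_suffix m a b t j : (j <= m)%N ->
  tail (m - j) (fun i => a (i + j)%N) 0 t <= 2 * tail m a b t.
Proof.
elim: m a b j => [|m IH] a b [|j] // jm.
1,2: rewrite subn0 (_ : (fun i => _) = a) ?tail_center //.
1,2: by apply/funext => i; rewrite addn0.
- rewrite subSS tailS; set a' := fun i => a i.+1.
  have := IH a' (b + a 0%N) j jm; have := IH a' (b - a 0%N) j jm.
  rewrite (_ : tail _ _ _ _ = tail (m - j) (fun i => a (i + j.+1)%N) 0 t); first lra.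
  by congr tail; apply/funext => i; rewrite /a' addnS.
Qed.

(* Decomposing at the first partial sum exceeding [s]; [B] bounds the tails of
   all the remaining sums. *)
Lemma kahane_start m a b s t B : 0 <= t ->
  (forall j, (j <= m)%N -> tail (m - j) (fun i => a (i + j)%N) 0 t <= B) ->
  `|b| <= s -> tail m a b (s + t) <= B * (2 * tail m a b s).
Proof.
move=> t0; elim: m a b => [|m IH] a b hB bs.
  rewrite !tail0 !(ltNge, bs) /= (le_trans bs) ?lerDl //=.
  by rewrite mulr0 mulr0.
set a' := fun i => a i.+1.
have hB' j : (j <= m)%N -> tail (m - j) (fun i => a' (i + j)%N) 0 t <= B.
  move=> jm; have := hB j.+1 jm; rewrite subSS.
  by rewrite (_ : (fun i => _) = fun i => a' (i + j)%N) //; apply/funext => i; rewrite addnS.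
have B0 : tail m.+1 a 0 t <= B.
  have := hB 0%N isT; rewrite subn0.
  by rewrite (_ : (fun i => _) = a) //; apply/funext => i; rewrite addn0.
have Ba : tail m a' (a 0%N) t <= B.
  by move: B0; rewrite tailS sub0r tailN add0r; lra.
have Bge0 : 0 <= B by apply: le_trans B0; apply: tail_ge0.
suff H c : `|c| = `|a 0%N| -> tail m a' (b + c) (s + t) <= B * (2 * tail m a' (b + c) s).
  rewrite !tailS -/a'; have := H (a 0%N) erefl; have := H (- a 0%N) (normrN _); lra.
move=> hc; case: (leP `|b + c| s) => h; first exact: IH.
(* First passage at this term: as [|b| <= s], the sum from this term on has to exceed [t], which has
   probability at most [B], whereas [tail_gt] bounds [2 * tail m a' (b + c) s] below by 1. *)
have h1 := tail_gt m a' h; apply: le_trans (tail_shift _ _ _ _ bs) _.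
apply: (@le_trans _ _ B); last by rewrite ler_peMr.
apply: le_trans Ba; move/eqP: hc; rewrite eqr_norm2 => /orP[]/eqP -> //.
by rewrite tailN.
Qed.

Lemma kahane m a s t : 0 <= s -> 0 <= t ->
  tail m a 0 (s + t) <= 4 * tail m a 0 s * tail m a 0 t.
Proof.
move=> s0 t0; have := @kahane_start m a 0 s t (2 * tail m a 0 t) t0.
by rewrite normr0 => /(_ (fun j => @tail_suffix m a 0 t j) s0); lra.
Qed.

(** Kahane's inequality with both levels equal to [2 ^+ k * z] bounds the next tail by 4 times a
    square; as 4 times a tail is at most 1/4 here, each doubling of the level gains a factor 1/4. *)
Lemma tail_dyadic m a z k : 0 <= z -> 16 * tail m a 0 z <= 1 ->
  tail m a 0 (2 ^+ k * z) <= 4^-1 ^+ k * tail m a 0 z.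
Proof.
move=> z0 hz; elim: k => [|k IH]; first by rewrite !expr0 !mul1r.
have -> : 2 ^+ k.+1 * z = 2 ^+ k * z + 2 ^+ k * z by rewrite exprS; ring.
have kz : 0 <= 2 ^+ k * z by rewrite mulr_ge0 ?exprn_ge0.
apply: le_trans (kahane _ _ kz kz) _; rewrite exprS -mulrA.
have h : tail m a 0 (2 ^+ k * z) <= tail m a 0 z.
  by apply: le_tail; rewrite ler_peMl // exprn_ege1 // ler1n.
have := tail_ge0 m a 0 (2 ^+ k * z); nra.
Qed.

Lemma tail_large m a b t :
  `|b| + \sum_(i < m) `|a i| <= t -> tail m a b t = 0.
Proof.
move=> h; rewrite -(av_cst m 0); apply: eq_av => e he.
suff -> : (t < `|b + \sum_(i < m) a i * e i|) = false by [].
apply/negbTE; rewrite -leNgt; apply: le_trans h.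
apply: le_trans (ler_normD _ _) _; rewrite lerD2l.
apply: le_trans (ler_norm_sum _ _ _) _; apply: ler_sum => i _.
by rewrite normrM; case: (he i) => ->; rewrite ?normrN normr1 mulr1.
Qed.

(** * Excess of sign sums over a level *)

Definition excess m a z : R :=
  av m (fun e => Num.max (`|\sum_(i < m) a i * e i| - z) 0).

(** A dyadic layer-cake bound: when [y] lies between [2 ^+ j * z] and [2 ^+ j.+1 * z], the levels
    below it sum to [(2 ^+ j.+1 - 1) * z], which is at least [y - z]. *)
Lemma excess_layers (z y : R) n : 0 < z -> y <= 2 ^+ n * z ->
  Num.max (y - z) 0 <= \sum_(k < n) 2 ^+ k * z * (2 ^+ k * z < y)%R%:R.
Proof.
move=> z0; elim: n => [|n IH] hy.
  by rewrite big_ord0 ge_max lexx andbT; move: hy; rewrite expr0; lra.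
have nz : 0 < 2 ^+ n * z by rewrite mulr_gt0 // exprn_gt0.
rewrite big_ord_recr /=; case: (ltP (2 ^+ n * z) y) => h; last first.
  by rewrite mulr0 addr0 IH.
rewrite mulr1 ge_max; apply/andP; split; last first.
  apply: addr_ge0 (ltW nz); apply: sumr_ge0 => i _.
  by rewrite mulr_ge0 ?mulr_ge0 ?exprn_ge0 // ltW.
have h1 j : (j <= n)%N -> 2 ^+ j * z - z <=
    \sum_(k < j) 2 ^+ k * z * (2 ^+ k * z < y)%R%:R.
  elim: j => [|j IHj] jn; first by rewrite big_ord0 expr0; lra.
  rewrite big_ord_recr /=.
  have -> : 2 ^+ j * z < y.
    by apply: le_lt_trans h; rewrite ler_pM2r // ler_eXn2l ?ltr1n // ltnW.
  by have := IHj (ltnW jn); rewrite exprS /=; lra.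
have := h1 n (leqnn n).
by move: hy; rewrite exprS; lra.
Qed.

(** The layer of level [2 ^+ k * z] contributes at most [2 ^+ k * 4^-1 ^+ k] times
    [z * tail m a 0 z], and the geometric series stays below 2. *)
Lemma excess_le m a z : 0 < z -> 16 * tail m a 0 z <= 1 ->
  excess m a z <= 2 * z * tail m a 0 z.
Proof.
move=> z0 hz; pose M := \sum_(i < m) `|a i|.
have [n hn] : exists n, M <= 2 ^+ n * z.
  exists (Num.bound (M / z)); have M0 : 0 <= M / z.
    by rewrite divr_ge0 ?(ltW z0) // sumr_ge0.
  have := archi_boundP M0; rewrite ltr_pdivrMr // => /ltW/le_trans; apply.
  by rewrite ler_pM2r // -natrX ler_nat ltnW // ltn_expl.
apply: (@le_trans _ _ (\sum_(k < n) 2 ^+ k * z * tail m a 0 (2 ^+ k * z))).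
  under eq_bigr do rewrite /tail -avZ.
  rewrite -(av_sum m n (fun k e => 2 ^+ k * z *
    (2 ^+ k * z < `|0 + \sum_(i < m) a i * e i|)%R%:R)).
  apply: le_av => e he; under [leRHS]eq_bigr do rewrite add0r.
  apply: excess_layers => //.
  apply: le_trans (ler_norm_sum _ _ _) (le_trans _ hn); apply: ler_sum => i _.
  by rewrite normrM; case: (he i) => ->; rewrite ?normrN normr1 mulr1.
apply: (@le_trans _ _ (\sum_(k < n) 2^-1 ^+ k * (z * tail m a 0 z))).
  apply: ler_sum => k _; rewrite -mulrA.
  apply: (@le_trans _ _ (2 ^+ k * (z * (4^-1 ^+ k * tail m a 0 z)))).
    by rewrite !ler_pM2l ?exprn_gt0 // tail_dyadic // ltW.
  rewrite le_eqVlt; apply/orP; left; apply/eqP.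
  have -> : 4^-1 ^+ k = 2^-1 ^+ k * 2^-1 ^+ k :> R.
    by rewrite -exprMn; congr (_ ^+ _); field.
  have h : 2 ^+ k * 2^-1 ^+ k = 1 :> R by rewrite -exprMn divff ?expr1n // pnatr_eq0.
  transitivity ((2 ^+ k * 2^-1 ^+ k) * (2^-1 ^+ k * (z * tail m a 0 z))).
    by set x := 2^-1 ^+ k; ring.
  by rewrite h mul1r.
rewrite -mulr_suml mulrA [_ * z]mulrC -!mulrA mulrCA [_ * (2 * _)]mulrCA.
have -> : \sum_(k < n) 2^-1 ^+ k = 2 - 2 * 2^-1 ^+ n :> R.
  elim: n {hn} => [|n IH]; first by rewrite big_ord0; ring.
  by rewrite big_ord_recr /= IH exprS; field.
have := tail_ge0 m a 0 z; have : 0 <= 2^-1 ^+ n :> R by rewrite exprn_ge0 // invr_ge0.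
move=> h1 h2; have := mulr_ge0 (mulr_ge0 h1 h2) (ltW z0); lra.
Qed.

(** The level grows by [2 ^+ r] while the tail shrinks by [4^-1 ^+ r]; the net gain makes the
    truncation error in [lower_step] small. *)
Lemma excess_dyadic m a z r : 0 < z -> 16 * tail m a 0 z <= 1 ->
  excess m a (2 ^+ r * z) <= 2 * 2^-1 ^+ r * z * tail m a 0 z.
Proof.
move=> z0 hz.
have rz : 0 < 2 ^+ r * z by rewrite mulr_gt0 // exprn_gt0.
have ht := tail_dyadic r (ltW z0) hz.
apply: le_trans (excess_le rz _) _.
  apply: le_trans hz; rewrite ler_pM2l //; apply: le_tail.
  by rewrite ler_peMl ?(ltW z0) // exprn_ege1 // ler1n.
apply: (@le_trans _ _ (2 * (2 ^+ r * z) * (4^-1 ^+ r * tail m a 0 z))).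
  by rewrite ler_pM2l // mulr_gt0.
have -> : 4^-1 ^+ r = 2^-1 ^+ r * 2^-1 ^+ r :> R.
  by rewrite -exprMn; congr (_ ^+ _); field.
have h : 2 ^+ r * 2^-1 ^+ r = 1 :> R by rewrite -exprMn divff ?expr1n // pnatr_eq0.
rewrite le_eqVlt; apply/orP; left; apply/eqP.
transitivity ((2 ^+ r * 2^-1 ^+ r) * (2 * 2^-1 ^+ r * z * tail m a 0 z)).
  by set x := 2^-1 ^+ r; ring.
by rewrite h mul1r.
Qed.

End signs.

(** * Bounded functions on a probability space *)

Section bounded.
Context d (T : measurableType d) (R : realType).
Variables (mu : {measure set T -> \bar R}) (D : set T).
Hypotheses (mD : measurable D) (muD : mu D = 1%E).
Implicit Types u v g : T -> R.

Definition bdd u :=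
  measurable_fun D u /\ exists M, forall x, D x -> `|u x| <= M.

Lemma bdd_cst c : bdd (fun=> c).
Proof. by split; [exact: measurable_cst | exists `|c|]. Qed.

Lemma bddD u v : bdd u -> bdd v -> bdd (fun x => u x + v x).
Proof.
move=> [mu' [M hM]] [mv [N hN]]; split; first exact: measurable_funD.
exists (M + N) => x Dx; apply: le_trans (ler_normD _ _) _.
by rewrite lerD ?hM ?hN.
Qed.

Lemma bddM u v : bdd u -> bdd v -> bdd (fun x => u x * v x).
Proof.
move=> [mu' [M hM]] [mv [N hN]]; split; first exact: measurable_funM.
by exists (M * N) => x Dx; rewrite normrM ler_pM ?hM ?hN.
Qed.

Lemma bddZ c u : bdd u -> bdd (fun x => c * u x).
Proof. by move=> hu; apply: bddM => //; apply: bdd_cst. Qed.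

Lemma bddX u n : bdd u -> bdd (fun x => u x ^+ n).
Proof.
move=> hu; elim: n => [|n IH]; first exact: bdd_cst.
by under eq_fun do rewrite exprS; apply: bddM.
Qed.

Lemma bdd_norm u : bdd u -> bdd (fun x => `|u x|).
Proof.
move=> [mu' [M hM]]; split; first exact: measurableT_comp.
by exists M => x Dx; rewrite normr_id hM.
Qed.

Lemma bdd_max0 u : bdd u -> bdd (fun x => Num.max (u x) 0).
Proof.
move=> [mu' [M hM]]; split.
  by apply: measurable_maxr => //; apply: measurable_cst.
exists M => x Dx; apply: le_trans (hM x Dx).
by rewrite maxEle; case: ifP => _; rewrite ?normr0.
Qed.

Lemma bdd_sum n (u : nat -> T -> R) : (forall i, (i < n)%N -> bdd (u i)) ->
  bdd (fun x => \sum_(i < n) u i x).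
Proof.
elim: n => [|n IH] hu.
  by under eq_fun do rewrite big_ord0; apply: bdd_cst.
under eq_fun do rewrite big_ord_recr /=.
by apply: bddD; [apply: IH => i /ltnW; apply: hu | apply: hu].
Qed.

Lemma bdd_indic (A : set T) : measurable A -> bdd (\1_A : T -> R).
Proof.
move=> mA; split; first exact: measurable_indic.
exists 1 => x _; rewrite indicE; case: (_ \in _); by rewrite ?normr0 ?normr1.
Qed.

Lemma bdd_integrable u : bdd u -> mu.-integrable D (EFin \o u).
Proof.
move=> [mu' [M hM]]; apply: measurable_bounded_integrable => //.
  by rewrite muD ltry.
exists (`|M|); split; first exact: num_real.
move=> y My x Dx; apply: le_trans (hM x Dx) _.
by apply: le_trans (ler_norm _) (ltW My).
Qed.

Definition mean u := Rintegral mu D u.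

Lemma eq_mean u v : (forall x, D x -> u x = v x) -> mean u = mean v.
Proof. by move=> uv; apply: eq_Rintegral => x; rewrite inE => /uv. Qed.

Lemma meanD u v : bdd u -> bdd v -> mean (fun x => u x + v x) = mean u + mean v.
Proof. by move=> hu hv; rewrite /mean RintegralD //; apply: bdd_integrable. Qed.

Lemma meanZ c u : bdd u -> mean (fun x => c * u x) = c * mean u.
Proof. by move=> hu; rewrite /mean RintegralZl //; apply: bdd_integrable. Qed.

Lemma mean_cst c : mean (fun=> c) = c.
Proof. by rewrite /mean Rintegral_cst // muD mulr1. Qed.

Lemma le_mean u v : bdd u -> bdd v -> (forall x, D x -> u x <= v x) ->
  mean u <= mean v.
Proof. by move=> hu hv uv; apply: le_Rintegral => //; apply: bdd_integrable. Qed.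

Lemma mean_ge0 u : (forall x, D x -> 0 <= u x) -> 0 <= mean u.
Proof. exact: Rintegral_ge0. Qed.

Lemma norm_mean u : bdd u -> `|mean u| <= mean (fun x => `|u x|).
Proof. by move=> hu; apply: le_normr_Rintegral => //; apply: bdd_integrable. Qed.

Lemma mean_sum n (u : nat -> T -> R) : (forall i, (i < n)%N -> bdd (u i)) ->
  mean (fun x => \sum_(i < n) u i x) = \sum_(i < n) mean (u i).
Proof.
elim: n => [|n IH] hu.
  by rewrite big_ord0 -[RHS](mean_cst 0); apply: eq_mean => x _; rewrite big_ord0.
rewrite big_ord_recr /= -IH; last by move=> i /ltnW; apply: hu.
rewrite -meanD; [|by apply: bdd_sum => i /ltnW; apply: hu|exact: hu].
by apply: eq_mean => x _; rewrite big_ord_recr.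
Qed.

Lemma mean_indic (A : set T) : measurable A -> (mean (\1_A))%:E = mu (D `&` A).
Proof.
move=> mA; rewrite /mean /Rintegral integral_indic // setIC fineK //.
have le1 : (mu (D `&` A) <= mu D)%E.
  by apply: le_measure => //; rewrite ?inE //; apply: measurableI.
by rewrite ge0_fin_numE // (le_lt_trans le1) // muD ltry.
Qed.

Lemma mean_restrict (A : set T) u : measurable A -> A `<=` D -> bdd u ->
  (mean (fun x => \1_A x * u x))%:E = (\int[mu]_(x in A) (u x)%:E)%E.
Proof.
move=> mA AD hu; have hAu := bddM (bdd_indic mA) hu.
rewrite /mean /Rintegral fineK; last exact: integrable_fin_num (bdd_integrable hAu).
rewrite -[in RHS](setIidr AD) integral_mkcondr; apply: eq_integral => x _.
by rewrite patchE indicE; case: (x \in A); rewrite ?mul1r ?mul0r.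
Qed.

Lemma measurable_gt u t : bdd u -> measurable (D `&` [set x | t < `|u x|]).
Proof.
move=> /bdd_norm[mu' _].
have -> : [set x | t < `|u x|] = (fun x => `|u x|) @^-1` `]t, +oo[%classic.
  by apply/seteqP; split => x /=; rewrite in_itv /= andbT.
exact: mu'.
Qed.

Lemma gt_indic u t x : D x ->
  (t < `|u x|)%R%:R = \1_(D `&` [set x | t < `|u x|]) x :> R.
Proof.
move=> Dx; rewrite indicE; congr (nat_of_bool _)%:R.
by apply/idP/idP => [h|]; [exact: mem_set | rewrite inE => -[]].
Qed.

Lemma bdd_gt u t : bdd u -> bdd (fun x => (t < `|u x|)%R%:R).
Proof.
move=> hu; split.
  have := @measurable_indic _ T R D _ (measurable_gt t hu).
  by apply: eq_measurable_fun => x; rewrite inE => Dx; rewrite gt_indic.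
by exists 1 => x _; case: (_ < _); rewrite ?normr0 ?normr1.
Qed.

Lemma mean_gt u t : bdd u ->
  mu (D `&` [set x | t < `|u x|]) = (mean (fun x => (t < `|u x|)%R%:R))%:E.
Proof.
move=> hu; rewrite (eq_mean (v := \1_(D `&` [set x | t < `|u x|]))).
  by rewrite mean_indic ?setIA ?setIid //; apply: measurable_gt.
exact: gt_indic.
Qed.

Lemma bdd_av m (G : T -> (nat -> R) -> R) : (forall e, bdd (G^~ e)) ->
  bdd (fun x => av m (G x)).
Proof.
elim: m G => [|m IH] G hG /=; first exact: hG.
under eq_fun do rewrite mulrC.
apply: bddZ; apply: bddD.
  by apply: (IH (fun x e => G x (scons 1 e))).
by apply: (IH (fun x e => G x (scons (-1) e))).
Qed.

Lemma mean_av m (G : T -> (nat -> R) -> R) : (forall e, bdd (G^~ e)) ->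
  mean (fun x => av m (G x)) = av m (fun e => mean (G^~ e)).
Proof.
elim: m G => [|m IH] G hG //=.
have h x : bdd (fun t => av m (fun e => G t (scons x e))).
  exact: (@bdd_av m (fun t e => G t (scons x e))).
rewrite -(IH (fun x e => G x (scons 1 e))) // -(IH (fun x e => G x (scons (-1) e))) //.
rewrite -meanD // mulrC -meanZ; last exact: bddD.
by apply: eq_mean => x _; rewrite mulrC.
Qed.

End bounded.

(** * Riesz products over a lacunary system *)

Section lacunary.
Context d (T : measurableType d) (R : realType).
Variables (mu : {measure set T -> \bar R}) (D : set T).
Hypotheses (mD : measurable D) (muD : mu D = 1%E).
Local Notation bdd := (@bdd d T R D).
Local Notation mean := (@mean d T R mu D).
Variable L : (T -> R) -> R.
Hypothesis LD : forall u v, bdd u -> bdd v -> L (fun x => u x + v x) = L u + L v.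
Hypothesis LZ : forall c u, bdd u -> L (fun x => c * u x) = c * L u.

(* [G n] collects the weighted Riesz products in [psi 0], ..., [psi n.-1], and
   [L g] stands for the limit of the means of [g * psi n ^+ 2]. *)
Record lacunary (psi : nat -> T -> R) (G : nat -> set (T -> R)) (eta : nat -> R) :=
  Lacunary {
  lac_bdd : forall n, bdd (psi n);
  lac_le1 : forall n x, D x -> `|psi n x| <= 1;
  lac_Gbdd : forall n g, G n g -> bdd g;
  lac_mono : forall n g, G n g -> G n.+1 g;
  lac_prod : forall n g (e : R), G n g -> e = 1 \/ e = -1 ->
    G n.+1 (fun x => g x * (1 + e * psi n x));
  lac_prod1 : forall n g (e : R), G n g -> e = 1 \/ e = -1 ->
    G n.+1 (fun x => psi n x * (g x * (1 + e * psi n x)));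
  lac_eta : forall n, 0 <= eta n;
  lac_mean : forall n g, G n g -> `|mean (fun x => g x * psi n x)| <= eta n;
  lac_lim : forall n g, G n g -> `|L (fun x => g x * psi n x)| <= eta n;
  lac_sqr : forall n g, G n g ->
    `|mean (fun x => g x * psi n x ^+ 2) - L g| <= eta n }.

(** Each segment starts the system at its own [k], late enough for the remaining errors to be small
    and for its indicator to belong to the initial family [G k]. *)
Lemma lacunary_shift psi G eta k : lacunary psi G eta ->
  lacunary (fun n => psi (k + n)%N) (fun n => G (k + n)%N) (fun n => eta (k + n)%N).
Proof.
case=> h1 h2 h3 h4 h5 h6 h7 h8 h9 h10.
split=> [n|n|n g|n g|n g e|n g e|n|n g|n g|n g]; rewrite ?addnS.
- exact: h1.
- exact: h2.
- exact: h3.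
- exact: h4.
- exact: h5.
- exact: h6.
- exact: h7.
- exact: h8.
- exact: h9.
- exact: h10.
Qed.

Variables (psi : nat -> T -> R) (G : nat -> set (T -> R)) (eta : nat -> R).
Hypothesis lac : lacunary psi G eta.
Variable kappa : R.
Hypothesis etak : forall n, \sum_(i < n) (2 * i + 3)%:R * eta i <= kappa.

Let psi_bdd := lac_bdd lac.

Definition riesz g (e : nat -> R) n : T -> R :=
  fun x => g x * \prod_(i < n) (1 + e i * psi i x).
Definition psum (a : nat -> R) n : T -> R := fun x => \sum_(i < n) a i * psi i x.

Lemma riesz0 g e : riesz g e 0 = g.
Proof. by apply/funext => x; rewrite /riesz big_ord0 mulr1. Qed.

Lemma rieszS g e n : riesz g e n.+1 = fun x => riesz g e n x * (1 + e n * psi n x).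
Proof. by apply/funext => x; rewrite /riesz big_ord_recr /= mulrA. Qed.

Lemma psumS a n : psum a n.+1 = fun x => psum a n x + a n * psi n x.
Proof. by apply/funext => x; rewrite /psum big_ord_recr. Qed.

Lemma psum_bdd a n : bdd (psum a n).
Proof. by apply: (bdd_sum (u := fun i x => a i * psi i x)) => i _; apply: bddZ. Qed.

Lemma G_riesz g e n : G 0%N g -> is_sign e -> G n (riesz g e n).
Proof.
move=> hg he; elim: n => [|n IH]; first by rewrite riesz0.
by rewrite rieszS; apply: (lac_prod lac).
Qed.

Lemma riesz_bdd g e n : bdd g -> bdd (riesz g e n).
Proof.
move=> hg; elim: n => [|n IH]; first by rewrite riesz0.
rewrite rieszS; apply: bddM => //; apply: bddD; first exact: bdd_cst.
exact: bddZ.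
Qed.

(** Prepares the cross terms of [moment_riesz], which contain [psi j] next to a later [psi n]:
    [lac_prod1] inserts [psi j] and [lac_prod] keeps it. *)
Lemma G_psi_riesz g e n j : G 0%N g -> is_sign e -> (j < n)%N ->
  G n (fun x => psi j x * riesz g e n x).
Proof.
move=> hg he; elim: n => // n IH; rewrite ltnS leq_eqVlt => /orP[/eqP->|/IH h].
  rewrite rieszS; apply: (lac_prod1 lac) => //; exact: G_riesz.
rewrite rieszS; under eq_fun do rewrite mulrA.
exact: (lac_prod lac).
Qed.

Lemma eta_sum n : \sum_(i < n) eta i <= kappa.
Proof.
apply: le_trans (etak n); apply: ler_sum => i _.
by rewrite ler_peMl ?(lac_eta lac) // ler1n addnS.
Qed.

Lemma mean_riesz g e n : G 0%N g -> is_sign e ->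
  `|mean (riesz g e n) - mean g| <= \sum_(i < n) eta i.
Proof.
move=> hg he; elim: n => [|n IH].
  by rewrite riesz0 subrr normr0 big_ord0.
have hr := riesz_bdd e n (lac_Gbdd lac hg).
have -> : mean (riesz g e n.+1) =
    mean (riesz g e n) + e n * mean (fun x => riesz g e n x * psi n x).
  have hp := bddM hr (psi_bdd n); rewrite -(meanZ mD muD (e n) hp).
  rewrite -(meanD mD muD hr (bddZ (e n) hp)).
  by apply: eq_mean => x _; rewrite rieszS; ring.
rewrite big_ord_recr /=.
have h := lac_mean lac (G_riesz n hg he).
have : `|e n * mean (fun x => riesz g e n x * psi n x)| <= eta n.
  by rewrite normrM; case: (he n) => ->; rewrite ?normrN normr1 mul1r.
set y := e n * _ => hy.
rewrite addrAC; apply: le_trans (ler_normD _ _) _; exact: lerD.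
Qed.

Lemma lim_rieszS g e n : G 0%N g ->
  L (riesz g e n.+1) = L (riesz g e n) + e n * L (fun x => riesz g e n x * psi n x).
Proof.
move=> hg; have hr := riesz_bdd e n (lac_Gbdd lac hg).
have hp := bddM hr (psi_bdd n); rewrite -(LZ (e n) hp) -(LD hr (bddZ (e n) hp)).
by congr L; apply/funext => x; rewrite rieszS; ring.
Qed.

Lemma lim_riesz g e n : G 0%N g -> is_sign e ->
  `|L (riesz g e n) - L g| <= \sum_(i < n) eta i.
Proof.
move=> hg he; elim: n => [|n IH].
  by rewrite riesz0 subrr normr0 big_ord0.
rewrite lim_rieszS // big_ord_recr /=.
have h := lac_lim lac (G_riesz n hg he).
have : `|e n * L (fun x => riesz g e n x * psi n x)| <= eta n.
  by rewrite normrM; case: (he n) => ->; rewrite ?normrN normr1 mul1r.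
set y := e n * _ => hy.
rewrite addrAC; apply: le_trans (ler_normD _ _) _; exact: lerD.
Qed.

Lemma norm_signM (x y : R) : x = 1 \/ x = -1 -> `|x * y| = `|y|.
Proof. by rewrite normrM => -[] ->; rewrite ?normrN normr1 mul1r. Qed.

(* Comparing with [L (riesz g e n) * s_n] rather than [L g * s_n] makes the
   error at step [n] of order [n * eta n], hence summable. *)
Lemma moment_riesz g e a A n : G 0%N g -> is_sign e ->
  (forall i, (i < n)%N -> `|a i| <= A) ->
  `|mean (fun x => psum a n x * riesz g e n x) -
    L (riesz g e n) * \sum_(i < n) a i * e i| <=
  A * \sum_(i < n) (2 * i + 3)%:R * eta i.
Proof.
move=> hg he; elim: n => [|n IH] ha.
  rewrite !big_ord0 !mulr0 subr0 -[X in `|X|](_ : 0 = _) ?normr0 //.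
  rewrite -(mean_cst mD muD 0); apply: eq_mean => x _.
  by rewrite /psum big_ord0 mul0r.
have hr := riesz_bdd e n (lac_Gbdd lac hg).
have hs := psum_bdd a n.
have hp := psi_bdd n.
set s := \sum_(i < n) a i * e i in IH.
have hsA : `|s + a n * e n| <= n.+1%:R * A.
  have -> : s + a n * e n = \sum_(i < n.+1) a i * e i by rewrite big_ord_recr.
  apply: le_trans (ler_norm_sum _ _ _) _.
  rewrite (_ : n.+1%:R * A = \sum_(i < n.+1) A); last first.
    by rewrite sumr_const card_ord mulr_natl.
  by apply: ler_sum => i _; rewrite mulrC norm_signM // ha.
have IH' := IH (fun i h => ha i (ltnW h)).
have hA : 0 <= A by apply: le_trans (ha n (ltnSn n)).
rewrite lim_rieszS // ![\sum_(i < n.+1) _]big_ord_recr /= -/s.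
set P := riesz g e n in IH' hr *.
have hG : G n P by apply: G_riesz.
(* Of the four terms, the first is left to the induction, the middle two are small, and in the last
   one the mean is compared with [L P]. *)
have -> : mean (fun x => psum a n.+1 x * riesz g e n.+1 x) =
    mean (fun x => psum a n x * P x) +
    e n * mean (fun x => psum a n x * (P x * psi n x)) +
    a n * mean (fun x => P x * psi n x) +
    a n * e n * mean (fun x => P x * psi n x ^+ 2).
  have b1 : bdd (fun x => psum a n x * P x) by exact: bddM.
  have b2 : bdd (fun x => psum a n x * (P x * psi n x)) by do 2 apply: bddM => //.
  have b3 : bdd (fun x => P x * psi n x) by exact: bddM.
  have b4 : bdd (fun x => P x * psi n x ^+ 2) by apply: bddM => //; apply: bddX.
  have b2' := bddZ (e n) b2; have b3' := bddZ (a n) b3; have b4' := bddZ (a n * e n) b4.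
  rewrite -(meanZ mD muD (e n) b2) -(meanZ mD muD (a n) b3).
  rewrite -(meanZ mD muD (a n * e n) b4) -(meanD mD muD b1 b2').
  rewrite -(meanD mD muD (bddD b1 b2') b3') -(meanD mD muD (bddD (bddD b1 b2') b3') b4').
  by apply: eq_mean => x _; rewrite psumS rieszS -/P; ring.
set sg := mean (fun x => psum a n x * (P x * psi n x)).
have hsg : `|sg| <= n%:R * A * eta n.
  have -> : sg = \sum_(i < n) a i * mean (fun x => psi i x * P x * psi n x).
    rewrite (eq_bigr (fun i : 'I_n => mean (fun x => a i * (psi i x * P x * psi n x)))).
      rewrite -(mean_sum mD muD (u := fun i x => a i * (psi i x * P x * psi n x))).
        apply: eq_mean => x _; rewrite /psum mulr_suml; apply: eq_bigr => i _; ring.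
      by move=> i _; apply: bddZ; do 2 apply: bddM => //.
    by move=> i _; rewrite meanZ //; do 2 apply: bddM => //.
  apply: le_trans (ler_norm_sum _ _ _) _.
  rewrite (_ : n%:R * A * eta n = \sum_(i < n) (A * eta n)); last first.
    by rewrite sumr_const card_ord -mulrA mulr_natl.
  apply: ler_sum => i _; rewrite normrM; apply: ler_pM => //.
    by apply: ha; apply: ltnW; rewrite ltnS.
  by apply: (lac_mean lac); apply: G_psi_riesz.
have h1 := lac_mean lac hG; have h2 := lac_lim lac hG; have h3 := lac_sqr lac hG.
set y := mean (fun x => psum a n x * P x) in IH' *.
set r := mean (fun x => P x * psi n x) in h1 *.
set t := L (fun x => P x * psi n x) in h2 *.
set q := mean (fun x => P x * psi n x ^+ 2) in h3 *.
set l := L P in IH' h3 *.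
have -> : y + e n * sg + a n * r + a n * e n * q - (l + e n * t) * (s + a n * e n) =
  (y - l * s) + e n * sg + a n * r + e n * (a n * (q - l)) +
   e n * (- t * (s + a n * e n)) by ring.
have hn : `|a n| <= A by apply: ha.
(* [2 * n + 3] counts [n] cross terms, one linear term, one replacement of the square by [L P], and
   [n + 1] for the change of [L P] against the new sum. *)
have -> : A * (\sum_(i < n) (2 * i + 3)%:R * eta i + (2 * n + 3)%:R * eta n) =
  A * (\sum_(i < n) (2 * i + 3)%:R * eta i) + n%:R * A * eta n + A * eta n +
  A * eta n + eta n * (n.+1%:R * A).
  by rewrite natrD natrM -natr1; ring.
have tri (x1 x2 y1 y2 : R) : `|x1| <= y1 -> `|x2| <= y2 -> `|x1 + x2| <= y1 + y2.
  by move=> k1 k2; apply: le_trans (ler_normD _ _) (lerD k1 k2).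
apply: (tri); [apply: (tri); [apply: (tri); [apply: (tri)|]|]|].
- exact: IH'.
- by rewrite norm_signM.
- by rewrite normrM ler_pM.
- by rewrite norm_signM // normrM ler_pM.
- by rewrite norm_signM // normrM normrN ler_pM.
Qed.

Hypothesis kappa1 : kappa <= 1.
Hypothesis G1 : G 0%N (fun=> 1).

Lemma mean_riesz_le2 g e n : G 0%N g -> is_sign e -> mean g <= 1 ->
  mean (riesz g e n) <= 2.
Proof.
move=> hg he g1; have := mean_riesz n hg he; have := eta_sum n.
rewrite ler_norml lerBlDr => h /andP[_] /le_trans; apply.
by apply: (le_trans (lerD (le_trans h kappa1) g1)).
Qed.

Lemma riesz_nneg g e n x : (forall x, D x -> 0 <= g x) -> is_sign e -> D x ->
  0 <= riesz g e n x.
Proof.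
move=> g0 he Dx; rewrite mulr_ge0 ?g0 //.
by apply: (riesz_ge0 (u := psi^~ x)) => // i _; apply: (lac_le1 lac).
Qed.

(** Jensen's inequality holds at each point; exchanging the two means leaves, for fixed signs, a
    Riesz product whose mean in [x] is at most 2. *)
Lemma mean_excess a m z :
  mean (fun x => Num.max (`|psum a m x| - z) 0) <= 2 * excess m a z.
Proof.
have hb c : bdd (fun x => Num.max (`|psum a m x| - c) 0).
  by apply: bdd_max0 => //; apply: bddD; [apply/bdd_norm/psum_bdd | exact: bdd_cst].
pose F x (e : nat -> R) := Num.max (`|\sum_(i < m) a i * e i| - z) 0 *
  riesz (fun=> 1) e m x.
have hF e : bdd (F ^~ e) by apply: bddZ; apply: riesz_bdd; apply: bdd_cst.
apply: (@le_trans _ _ (mean (fun x => av m (F x)))).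
  apply: le_mean => //; first exact: bdd_av.
  move=> x Dx; apply: le_trans (jensen_riesz _ _ (u := psi^~ x) _) _.
    by move=> i _; apply: (lac_le1 lac).
  by apply: le_av => e _; rewrite /F /riesz mul1r.
rewrite (mean_av mD muD) // /excess -avZ; apply: le_av => e he.
rewrite meanZ //; last by apply: riesz_bdd; apply: bdd_cst.
rewrite mulrC ler_wpM2r ?le_max ?lexx ?orbT //.
by apply: mean_riesz_le2 => //; rewrite mean_cst.
Qed.

Lemma gt_le_max (y w : R) : 0 < w -> w * (2 * w < y)%R%:R <= Num.max (y - w) 0.
Proof.
move=> w0; rewrite le_max.
by case: (ltP (2 * w) y) => h; apply/orP; [left|right]; rewrite /=; lra.
Qed.

Lemma upper_tail a m w : 0 < w ->
  mean (fun x => (2 * w < `|psum a m x|)%R%:R) <= 16 * tail m a 0 w.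
Proof.
move=> w0; have hS := psum_bdd a m; have hgt := bdd_gt mD (2 * w) hS.
(* If the tail exceeds 1/16, the right side exceeds 1. Otherwise Markov's inequality is combined
   with [excess_le]. *)
case: (leP (16 * tail m a 0 w) 1) => h; last first.
  apply: le_trans (ltW h); rewrite -[leRHS](mean_cst mD muD).
  by apply: le_mean => //; [exact: bdd_cst | move=> x _; case: (_ < _)].
have hb : bdd (fun x => Num.max (`|psum a m x| - w) 0).
  by apply: bdd_max0 => //; apply: bddD; [exact: bdd_norm | exact: bdd_cst].
have h1 : w * mean (fun x => (2 * w < `|psum a m x|)%R%:R) <=
    mean (fun x => Num.max (`|psum a m x| - w) 0).
  rewrite -meanZ //; apply: le_mean => //; first exact: bddZ.
  by move=> x _; apply: gt_le_max.
have := mean_excess a m w; have := excess_le w0 h; have := tail_ge0 m a 0 w.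
move=> t0 h2 h3; rewrite -(ler_pM2l w0); nra.
Qed.

(** For signs whose sum exceeds [v], [moment_riesz] forces the mean of [|psum a m x|] against
    [riesz g e m] to be of order [c * v]. Averaging over the signs replaces the Riesz product by
    [g], and truncation turns the first moment into a tail. *)
Lemma lower_step g a m v c r : G 0%N g -> (forall x, D x -> 0 <= g x <= 1) ->
  L g = c -> 0 < c -> 6 * kappa <= c -> 0 < v -> 16 * tail m a 0 (2 * v) <= 1 ->
  64 <= c * 2 ^+ r ->
  c * tail m a 0 v <= 8 * 2 ^+ r *
    mean (fun x => (c * v / 16 < `|psum a m x|)%R%:R * g x).
Proof.
move=> hg g01 Lg c0 kc v0 hv hr.
have g0 x : D x -> 0 <= g x by move=> /g01/andP[].
have bg := lac_Gbdd lac hg.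
have mg1 : mean g <= 1.
  rewrite -(mean_cst mD muD 1); apply: le_mean => //; first exact: bdd_cst.
  by move=> x /g01/andP[].
have hS := psum_bdd a m; set S := psum a m in hS *.
(* The tail at [2 * v] is below 1/2, so no coefficient exceeds [2 * v]; this is the [A] of
   [moment_riesz]. *)
have ha i : (i < m)%N -> `|a i| <= 2 * v.
  move=> im; rewrite leNgt; apply/negP => /(tail_coef 0 im); lra.
set th := c * v / 16; set M := 2 ^+ r * (2 * v).
have M0 : 0 <= M by rewrite mulr_ge0 ?exprn_ge0 ?mulr_ge0 // ltW.
have th0 : 0 < th by rewrite /th; apply: divr_gt0 => //; exact: mulr_gt0.
pose X1 x : R := (th < `|S x|)%R%:R.
pose X2 x := Num.max (`|S x| - M) 0.
have bX1 : bdd X1 by exact: bdd_gt.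
have bX2 : bdd X2.
  by apply: bdd_max0 => //; apply: bddD; [exact: bdd_norm | exact: bdd_cst].
pose W x := M * X1 x + X2 x.
have bW : bdd W by apply: bddD => //; apply: bddZ.
have X20 x : 0 <= X2 x by rewrite le_max lexx orbT.
have W0 x : 0 <= W x by rewrite addr_ge0 // mulr_ge0 // ler0n.
(* Small values are absorbed by [th], larger ones up to [M] by [M * X1 x], and the rest by the
   excess [X2 x]. *)
have SW x : `|S x| <= th + W x.
  rewrite /W /X1; have : `|S x| - M <= X2 x by rewrite le_max lexx.
  by have := X20 x; case: (ltP th) => h /=; lra.
have nt (p q : R) : `|p| <= `|q| + `|q - p|.
  by have := ler_normB q (q - p); rewrite subKr.
(* Of [c * v], at most [3 * kappa * v <= c * v / 2] is lost to the errors and [2 * th = c * v / 8]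
   to small values; [3 * c / 8 * v] is left. *)
have pointwise e : is_sign e ->
    3 * c / 8 * v * (v < `|0 + \sum_(i < m) a i * e i|)%R%:R <=
    mean (fun x => W x * riesz g e m x).
  move=> he; rewrite add0r; set s := \sum_(i < m) _.
  have bP := riesz_bdd e m bg.
  have P0 x : D x -> 0 <= riesz g e m x by move=> Dx; apply: riesz_nneg.
  case: (ltP v `|s|) => hs; last first.
    by rewrite mulr0; apply: mean_ge0 => x Dx; rewrite mulr_ge0 ?P0.
  have := moment_riesz hg he ha; rewrite -/s -/S.
  have := lim_riesz m hg he; rewrite Lg.
  have := etak m; have := eta_sum m; set k1 := \sum_(i < m) _; set k2 := \sum_(i < m) _.
  set y := mean _; set l := L _ => hk1 hk2 hl hy.
  have hP2 := mean_riesz_le2 m hg he mg1.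
  have hyW : `|y| <= th * 2 + mean (fun x => W x * riesz g e m x).
    apply: le_trans (norm_mean mD muD (bddM hS bP)) _.
    apply: (@le_trans _ _ (mean (fun x => th * riesz g e m x + W x * riesz g e m x))).
      apply: le_mean => //; first by apply: bdd_norm; exact: bddM.
        by apply: bddD; [exact: bddZ | exact: bddM].
      move=> x Dx; rewrite normrM [X in _ * X]ger0_norm ?P0 // -mulrDl.
      by apply: ler_wpM2r; [exact: P0 | exact: SW].
    rewrite meanD //; [|exact: bddZ|exact: bddM].
    by rewrite lerD2r meanZ // ler_pM2l.
  have hl' : c - kappa <= `|l|.
    have := nt c l; rewrite gtr0_norm //.
    by move: hl hk1; lra.
  have hls : (c - kappa) * v <= `|l * s|.
    rewrite normrM; apply: ler_pM => //; [lra | exact: ltW | exact: ltW].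
  have hys : `|l * s| <= `|y| + 2 * v * kappa.
    have hv2 : 2 * v * k2 <= 2 * v * kappa by rewrite ler_pM2l //; lra.
    have := nt (l * s) y.
    by move: hy hv2; lra.
  rewrite mulr1; move: hyW hls hys; rewrite /th; set q := mean _.
  have : kappa * v <= c / 6 * v by rewrite ler_pM2r //; lra.
  by lra.
have av_le : 3 * c / 8 * v * tail m a 0 v <= mean (fun x => W x * g x).
  apply: (@le_trans _ _ (av m (fun e => mean (fun x => W x * riesz g e m x)))).
    by rewrite /tail -avZ; apply: le_av.
  rewrite -(@mean_av _ _ _ _ _ mD muD m (fun x e => W x * riesz g e m x)); last first.
    by move=> e; apply: bddM => //; apply: riesz_bdd.
  rewrite (@eq_mean _ _ _ _ _ _ (fun x => W x * g x)) // => x _.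
  rewrite /riesz; under eq_av do rewrite mulrA.
  by rewrite avZ (av_riesz1 m (psi^~ x)) mulr1.
have hW : mean (fun x => W x * g x) <= M * mean (fun x => X1 x * g x) + mean X2.
  rewrite -meanZ //; last exact: bddM.
  rewrite -meanD //; last by apply: bddZ; exact: bddM.
  apply: le_mean => //; first exact: bddM.
    by apply: bddD => //; apply: bddZ; exact: bddM.
  move=> x Dx; rewrite /W mulrDl -mulrA lerD2l ler_piMr //.
  by have /andP[] := g01 _ Dx.
(* The choice of [r] gives [8 * 2^-1 ^+ r <= c / 8], so the excess over [M] uses up only [c / 8] of
   the [3 * c / 8]. *)
have hX2 : mean X2 <= c / 8 * v * tail m a 0 v.
  apply: le_trans (mean_excess a m M) _.
  have v20 : 0 < 2 * v by rewrite mulr_gt0.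
  have hd := excess_dyadic r v20 hv.
  have ht : tail m a 0 (2 * v) <= tail m a 0 v by apply: le_tail; lra.
  apply: (@le_trans _ _ (2 * (2 * 2^-1 ^+ r * (2 * v) * tail m a 0 (2 * v)))).
    by rewrite ler_pM2l.
  have hc : 8 * 2^-1 ^+ r <= c / 8.
    have r0 : 0 < 2 ^+ r :> R by rewrite exprn_gt0.
    by rewrite exprVn ler_pdivrMr //; lra.
  have e0 : 0 <= 2^-1 ^+ r :> R by rewrite exprn_ge0 // invr_ge0.
  apply: (@le_trans _ _ (8 * 2^-1 ^+ r * (v * tail m a 0 v))).
    rewrite [leLHS](_ : _ = 8 * 2^-1 ^+ r * (v * tail m a 0 (2 * v))); last by ring.
    by apply: ler_wpM2l; [rewrite mulr_ge0 | rewrite ler_pM2l].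
  by rewrite -[leRHS]mulrA ler_wpM2r // mulr_ge0 ?tail_ge0 // ltW.
have : c / 4 * v * tail m a 0 v <= M * mean (fun x => X1 x * g x).
  by move: av_le hW hX2; set q1 := mean _; set q2 := mean _; set q3 := mean _; lra.
rewrite -/X1; set q := mean _ => hq; rewrite -(ler_pM2l v0).
by move: hq; rewrite /M; lra.
Qed.

(** [lower_step] requires a small tail at the doubled level, so it is used at the first level
    [2 ^+ j * v0] for which this holds; monotonicity then returns to [w]. *)
Lemma lower_tail g a m w c r : G 0%N g -> (forall x, D x -> 0 <= g x <= 1) ->
  L g = c -> 0 < c -> 6 * kappa <= c -> 0 < w -> 64 <= c * 2 ^+ r ->
  c * tail m a 0 (16 / c * w) <= 128 * 2 ^+ r *
    mean (fun x => (w < `|psum a m x|)%R%:R * g x).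
Proof.
move=> hg g01 Lg c0 kc w0 hr; set v0 := 16 / c * w.
have v00 : 0 < v0 by rewrite mulr_gt0 // divr_gt0.
have bg := lac_Gbdd lac hg; have hS := psum_bdd a m.
pose q t := mean (fun x => (t < `|psum a m x|)%R%:R * g x).
have q_ge0 t : 0 <= q t.
  by apply: mean_ge0 => x /g01/andP[? _]; rewrite mulr_ge0.
have q_anti s t : s <= t -> q t <= q s.
  move=> st; apply: le_mean => //; try by apply: bddM => //; apply: bdd_gt.
  move=> x /g01/andP[? _]; apply: ler_wpM2r => //; rewrite ler_nat.
  by case: (ltP t) => // /(le_lt_trans st) ->.
have step j : 16 * tail m a 0 (2 * (2 ^+ j * v0)) <= 1 ->
    c * tail m a 0 (2 ^+ j * v0) <= 8 * 2 ^+ r * q w.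
  move=> hj; have j0 : 0 < 2 ^+ j * v0 by rewrite mulr_gt0 // exprn_gt0.
  apply: le_trans (lower_step hg g01 Lg c0 kc j0 hj hr) _.
  rewrite ler_pM2l ?mulr_gt0 ?exprn_gt0 //; apply: q_anti.
  have -> : c * (2 ^+ j * v0) / 16 = 2 ^+ j * w by rewrite /v0; field; lra.
  by rewrite ler_peMl ?(ltW w0) // exprn_ege1 // ler1n.
rewrite -/(q w).
have ex : exists j, 16 * tail m a 0 (2 * (2 ^+ j * v0)) <= 1.
  pose N := \sum_(i < m) `|a i|; exists (Num.bound (N / v0)).
  rewrite tail_large ?mulr0 // normr0 add0r -/N.
  have N0 : 0 <= N / v0 by rewrite divr_ge0 ?(ltW v00) // sumr_ge0.
  have := archi_boundP N0; rewrite ltr_pdivrMr // => /ltW/le_trans; apply.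
  rewrite mulrA ler_pM2r // -exprS -natrX ler_nat.
  by rewrite ltnW // (leq_trans (ltn_expl _ (ltnSn 1))) // leq_exp2l.
have r0 : 0 < 2 ^+ r :> R by rewrite exprn_gt0.
(* If the first such level is [v0], the step applies directly. Otherwise minimality makes the tail
   at the chosen level exceed 1/16, so it controls the tail at [v0] up to a factor 16, and
   [16 * 8 = 128]. *)
case: (ex_minnP ex) => -[|j] hj jmin.
  have := step 0%N hj; rewrite expr0 mul1r => h; apply: le_trans h _.
  by have := mulr_ge0 (ltW r0) (q_ge0 w); lra.
have : 1 < 16 * tail m a 0 (2 ^+ j.+1 * v0).
  rewrite ltNge; apply/negP; rewrite exprS -mulrA => /jmin.
  by rewrite ltnn.
have := step _ hj; have := tail_le1 m a 0 v0; set t := tail _ _ _ _ ; set t' := tail _ _ _ _.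
have := q_ge0 w; set y := q w => y0 h1 h2 h3.
have : c * t <= c * (16 * t') by rewrite ler_pM2l //; lra.
by move: h2; lra.
Qed.

End lacunary.

(** * Selection of a lacunary subsequence *)

(** Compactness gives a cluster point, and an ultrafilter converges to each of its cluster
    points. *)
Lemma ultra_bounded_cvg (R : realType) (U : set_system nat) (v : nat -> R) M :
  UltraFilter U -> (forall n, `|v n| <= M) -> cvg (v @ U).
Proof.
move=> hU hv; have hP : ProperFilter U by exact: ultra_proper.
have [p [_ clp]] : `[- M, M] `&` cluster (v @ U) !=set0.
  apply: (@segment_compact R (- M) M (v @ U)).
  by apply: (@filterE _ U) => n /=; rewrite in_itv /= -ler_norml.
apply/cvg_ex; exists p => B nB.
have [//|h] := in_ultra_setVsetC (v @^-1` B) hU.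
by have [x []] := clp (~` B) B h nB.
Qed.

Section selection.
Context d (T : measurableType d) (R : realType).
Variables (mu : {measure set T -> \bar R}) (D : set T).
Hypotheses (mD : measurable D) (muD : mu D = 1%E).
Local Notation bdd := (@bdd d T R D).
Local Notation mean := (@mean d T R mu D).
Variable F : nat -> T -> R.
Hypothesis F_bdd : forall k, bdd (F k).
Hypothesis F_le1 : forall k x, D x -> `|F k x| <= 1.
Hypothesis F_weak : forall u, bdd u -> mean (fun x => F k x * u x) @[k --> \oo] --> (0 : R).
Variable U : set_system nat.
Hypotheses (hU : UltraFilter U) (ooU : \oo `<=` U).

Let U_proper : ProperFilter U. Proof. exact: ultra_proper. Qed.

Definition sqlim (u : T -> R) : R := lim (mean (fun x => u x * F k x ^+ 2) @[k --> U]).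

Let sq_bdd u k : bdd u -> bdd (fun x => u x * F k x ^+ 2).
Proof. by move=> hu; apply: bddM => //; apply: bddX. Qed.

Lemma norm_sq u k : bdd u -> `|mean (fun x => u x * F k x ^+ 2)| <= mean (fun x => `|u x|).
Proof.
move=> hu; apply: le_trans (norm_mean mD muD (sq_bdd k hu)) _.
apply: le_mean => //; [exact/bdd_norm/sq_bdd | exact: bdd_norm | move=> x Dx].
by rewrite normrM ler_piMr // normrX exprn_ile1 // F_le1.
Qed.

Lemma sqlim_cvg u : bdd u -> mean (fun x => u x * F k x ^+ 2) @[k --> U] --> sqlim u.
Proof.
by move=> hu; apply: (ultra_bounded_cvg (M := mean (fun x => `|u x|))) => // k; apply: norm_sq.
Qed.

Lemma sqlimD u v : bdd u -> bdd v -> sqlim (fun x => u x + v x) = sqlim u + sqlim v.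
Proof.
move=> hu hv; apply: cvg_lim => //.
rewrite (_ : (fun k => _) = fun k => mean (fun x => u x * F k x ^+ 2) +
                                     mean (fun x => v x * F k x ^+ 2)).
  by apply: cvgD; apply: sqlim_cvg.
apply/funext => k; rewrite -(meanD mD muD (sq_bdd k hu) (sq_bdd k hv)).
by apply: eq_mean => x _; rewrite mulrDl.
Qed.

Lemma sqlimZ c u : bdd u -> sqlim (fun x => c * u x) = c * sqlim u.
Proof.
move=> hu; apply: cvg_lim => //.
rewrite (_ : (fun k => _) = fun k => c * mean (fun x => u x * F k x ^+ 2)).
  by apply: cvgMr; apply: sqlim_cvg.
apply/funext => k; rewrite -(meanZ mD muD c (sq_bdd k hu)).
by apply: eq_mean => x _; rewrite mulrA.
Qed.

Lemma sqlim_ge c u : bdd u -> (\forall k \near \oo, c <= mean (fun x => u x * F k x ^+ 2)) ->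
  c <= sqlim u.
Proof.
by move=> hu h; apply: limr_ge; [exact: sqlim_cvg | exact: ooU].
Qed.

Lemma sqlim_le c u : bdd u -> (forall k, mean (fun x => u x * F k x ^+ 2) <= c) ->
  sqlim u <= c.
Proof.
by move=> hu h; apply: limr_le; [exact: sqlim_cvg | exact: nearW].
Qed.

(** Cauchy-Schwarz without square roots: [|u| <= (l + u ^+ 2 / l) / 2] for each [l > 0], and
    [F k ^+ 2 <= 1]. *)
Lemma sqlim_amgm u (l : R) : bdd u -> 0 < l ->
  sqlim u <= (l + mean (fun x => u x ^+ 2) / l) / 2.
Proof.
move=> hu l0; apply: sqlim_le => // k; apply: le_trans (ler_norm _) _.
apply: le_trans (norm_sq k hu) _.
have b2 := bddX 2 hu.
have -> : (l + mean (fun x => u x ^+ 2) / l) / 2 =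
    mean (fun x => l / 2 + (l^-1 / 2) * u x ^+ 2).
  have bc : bdd (fun=> l / 2) by exact: bdd_cst.
  rewrite (meanD mD muD bc (bddZ _ b2)) (meanZ mD muD _ b2) (mean_cst mD muD).
  by field; lra.
apply: le_mean => //; first exact: bdd_norm.
  by apply: bddD; [exact: bdd_cst | exact: bddZ].
move=> x _; rewrite -[u x ^+ 2]real_normK ?num_real //; set y := `|u x|.
rewrite -subr_ge0 (_ : _ - _ = (l^-1 / 2) * (l - y) ^+ 2); last by field; lra.
by rewrite mulr_ge0 ?sqr_ge0 // divr_ge0 // invr_ge0 ltW.
Qed.

(* Otherwise, adding almost orthogonal terms [+- g * F i] would produce [u] with
   [sqlim u] of order [n] and norm in [L2] of order [sqrt n]. *)
Lemma sqlim_weak g eta : bdd g -> 0 < eta ->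
  \forall i \near \oo, `|sqlim (fun x => g x * F i x)| <= eta.
Proof.
move=> hg eta0; apply: contrapT => hneg.
have bad N : exists2 i, (N <= i)%N & eta < `|sqlim (fun x => g x * F i x)|.
  apply: contrapT => h; apply: hneg; exists N => // i /= Ni.
  by rewrite leNgt; apply/negP => hi; apply: h; exists i.
have [_ [M hM]] := hg; pose M2 := M ^+ 2.
have hM2 i : mean (fun x => (g x * F i x) ^+ 2) <= M2.
  rewrite -(mean_cst mD muD M2); apply: le_mean => //.
  - by apply: bddX; exact: bddM.
  - exact: bdd_cst.
  move=> x Dx; rewrite -[leLHS]real_normK ?num_real // normrM.
  have M0 : 0 <= M := le_trans (normr_ge0 _) (hM x Dx).
  apply: lerXn2r; rewrite ?nnegrE ?mulr_ge0 //.
  by rewrite -[M]mulr1; apply: ler_pM => //; [exact: hM | exact: F_le1].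
have M20 : 0 <= M2 by exact: sqr_ge0.
have grow n : exists u, [/\ bdd u, n%:R * eta <= sqlim u &
    mean (fun x => u x ^+ 2) <= n%:R * (M2 + 1)].
  elim: n => [|n [u [hu Lu Eu]]].
    exists (fun=> 0); split; first exact: bdd_cst.
      rewrite mul0r; apply: sqlim_ge; first exact: bdd_cst.
      by apply: nearW => k; apply: mean_ge0 => x _; rewrite mul0r.
    rewrite mul0r (_ : (fun x => _) = fun=> 0) ?mean_cst //.
    by apply/funext => x; rewrite expr0n.
  have hug : bdd (fun x => u x * g x) by exact: bddM.
  (* Weak convergence provides an index at which the cross term is at most 1/2, so that the new term
     raises the mean square by at most [M2 + 1]. *)
  have := F_weak hug; move=> /cvgrPdist_le /(_ (2^-1)).
  move=> /(_ (ltac:(rewrite invr_gt0; exact: ltr0n)))[N _ hN].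
  have [i Ni hi] := bad N; have := hN i Ni; rewrite sub0r normrN.
  set y := mean _ => hy.
  have hgF : bdd (fun x => g x * F i x) by exact: bddM.
  have [s s1 hs] : exists2 s : R, s = 1 \/ s = -1 & eta <= s * sqlim (fun x => g x * F i x).
    move: hi; case: (ger0P (sqlim (fun x => g x * F i x))) => _ hi.
      by exists 1; [left | rewrite mul1r ltW].
    by exists (-1); [right | rewrite mulN1r ltW].
  exists (fun x => u x + s * (g x * F i x)); split.
  - by apply: bddD => //; apply: bddZ.
  - rewrite sqlimD ?sqlimZ //; last exact: bddZ.
    by rewrite -natr1 mulrDl mul1r lerD.
  - have b1 := bddX 2 hu; have b2 := bddX 2 hgF; have b3 := bddM (F_bdd i) hug.
    rewrite (@eq_mean _ _ _ _ _ _ (fun x => (u x ^+ 2 + 2 * s * (F i x * (u x * g x))) +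
       (g x * F i x) ^+ 2)); last first.
      by move=> x _; case: s1 => ->; ring.
    rewrite (meanD mD muD (bddD b1 (bddZ _ b3)) b2) (meanD mD muD b1 (bddZ _ b3)).
    rewrite (meanZ mD muD _ b3) -/y.
    have : 2 * s * y <= 1.
      move: hy; rewrite ler_norml => /andP[].
      by case: s1 => ->; lra.
    rewrite -natr1; have := hM2 i; lra.
(* For this [l], [sqlim_amgm] would give [n * eta <= l], contrary to the choice of [n] above
   [l / eta]. *)
pose l := (M2 + 1) / eta; have l0 : 0 < l by rewrite divr_gt0 //; lra.
have [u [hu Lu Eu]] := grow (Num.bound (l / eta)).
have le0 : 0 <= l / eta by rewrite divr_ge0 ?ltW.
have := archi_boundP le0; rewrite ltr_pdivrMr // => h1.
have := sqlim_amgm hu l0; set n := (Num.bound _)%:R in h1 Lu Eu *.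
have : mean (fun x => u x ^+ 2) / l <= n * eta.
  rewrite ler_pdivrMr //; apply: le_trans Eu _; rewrite /l.
  by rewrite (_ : n * eta * _ = n * (M2 + 1)) //; field; lra.
set q := _ / l; lra.
Qed.

(** The last condition is a limit along [U] only, so [k] is sought in a member of [U]; finitely many
    conditions can be intersected there, and [ooU] makes [k] as late as desired. *)
Lemma pick_next (Gs : seq (T -> R)) (N : nat) (eta : R) : 0 < eta ->
  (forall g, g \in Gs -> bdd g) ->
  exists k, (N < k)%N /\ forall g, g \in Gs ->
    [/\ `|mean (fun x => g x * F k x)| <= eta,
        `|sqlim (fun x => g x * F k x)| <= eta &
        `|mean (fun x => g x * F k x ^+ 2) - sqlim g| <= eta].
Proof.
move=> eta0 hG.
suff H : \forall k \near U, forall g, g \in Gs ->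
    [/\ `|mean (fun x => g x * F k x)| <= eta,
        `|sqlim (fun x => g x * F k x)| <= eta &
        `|mean (fun x => g x * F k x ^+ 2) - sqlim g| <= eta].
  have h2 : \forall k \near U, (N < k)%N by apply: ooU; exact: nbhs_infty_gt.
  by have [k hk] := filter_ex (filterI h2 H); exists k.
elim: Gs hG => [|g Gs IH] hG; first by apply: nearW => k g; rewrite in_nil.
have hg : bdd g by apply: hG; rewrite mem_head.
have h0 : \forall k \near U, forall g, g \in Gs ->
    [/\ `|mean (fun x => g x * F k x)| <= eta,
        `|sqlim (fun x => g x * F k x)| <= eta &
        `|mean (fun x => g x * F k x ^+ 2) - sqlim g| <= eta].
  by apply: IH => g' hg'; apply: hG; rewrite in_cons hg' orbT.
have h1 : \forall k \near U, `|mean (fun x => g x * F k x)| <= eta.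
  apply: ooU; have /cvgrPdist_le/(_ eta eta0) := F_weak hg.
  apply: filterS => k; rewrite sub0r normrN.
  by under eq_mean do rewrite mulrC.
have h2 : \forall k \near U, `|sqlim (fun x => g x * F k x)| <= eta.
  by apply: ooU; apply: sqlim_weak.
have h3 : \forall k \near U, `|mean (fun x => g x * F k x ^+ 2) - sqlim g| <= eta.
  have /cvgrPdist_le/(_ eta eta0) := sqlim_cvg hg.
  by apply: filterS => k; rewrite distrC.
near=> k => g'; rewrite in_cons => /orP[/eqP->|].
  by split; near: k.
by move: g'; near: k.
Unshelve. all: by end_near. Qed.

(** The closure that [lac_mono], [lac_prod] and [lac_prod1] demand. The factors [1] and [-1] are
    left unsimplified so as to match [e] after substitution. *)
Definition expand (psi : T -> R) (Gs : seq (T -> R)) : seq (T -> R) :=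
  flatten [seq [:: g; (fun x => g x * (1 + 1 * psi x));
                   (fun x => g x * (1 + -1 * psi x));
                   (fun x => psi x * (g x * (1 + 1 * psi x)));
                   (fun x => psi x * (g x * (1 + -1 * psi x)))] | g <- Gs].

Lemma expand_bdd psi Gs : bdd psi -> (forall g, g \in Gs -> bdd g) ->
  forall g, g \in expand psi Gs -> bdd g.
Proof.
move=> hpsi hGs g /flatten_mapP[h hh].
have bh := hGs _ hh.
have b e : bdd (fun x => h x * (1 + e * psi x)).
  by apply: bddM => //; apply: bddD; [exact: bdd_cst | exact: bddZ].
rewrite !inE => /or4P[/eqP->|/eqP->|/eqP->|/orP[]/eqP->] //; exact: bddM.
Qed.

Variables (J : nat -> T -> R) (eta : nat -> R).
Hypothesis J_bdd : forall n, bdd (J n).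
Hypothesis eta_gt0 : forall n, 0 < eta n.

Lemma lacunary_subseq : exists (j : nat -> nat) (G : nat -> set (T -> R)),
  [/\ {homo j : m n / (m < n)%N}, lacunary mu D sqlim (fun n => F (j n)) G eta,
      G 0%N (fun=> 1) & forall n, G n (J n)].
Proof.
have [next hnext] : {next : (seq (T -> R) * nat) * nat -> nat & forall s,
    (forall g, g \in s.1.1 -> bdd g) ->
    (s.1.2 < next s)%N /\ forall g, g \in s.1.1 ->
    [/\ `|mean (fun x => g x * F (next s) x)| <= eta s.2,
        `|sqlim (fun x => g x * F (next s) x)| <= eta s.2 &
        `|mean (fun x => g x * F (next s) x ^+ 2) - sqlim g| <= eta s.2]}.
  apply: (@choice _ _ (fun s k => (forall g, g \in s.1.1 -> bdd g) ->
    (s.1.2 < k)%N /\ forall g, g \in s.1.1 ->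
    [/\ `|mean (fun x => g x * F k x)| <= eta s.2,
        `|sqlim (fun x => g x * F k x)| <= eta s.2 &
        `|mean (fun x => g x * F k x ^+ 2) - sqlim g| <= eta s.2])) => s.
  (* The index 0 is a default for families with unbounded members; by [st_bdd] none occurs in the
     construction. *)
  have [h|h] := pselect (forall g, g \in s.1.1 -> bdd g); last by exists 0%N.
  by have [k hk] := pick_next s.1.2 (eta_gt0 s.2) h; exists k.
(* A state holds the current family and the last chosen index. [J n] joins at stage [n], so that
   countably many indicators enter while each family stays finite. *)
pose st := fix st n : seq (T -> R) * nat := if n is n'.+1 then
    let k := next (st n', n') in (J n :: expand (F k) (st n').1, k)
  else ([:: (fun=> 1); J 0%N], 0%N).
pose j n := next (st n, n).
have st_bdd n : forall g, g \in (st n).1 -> bdd g.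
  elim: n => [|n IH] g /=.
    by rewrite !inE => /orP[]/eqP->; [exact: bdd_cst | exact: J_bdd].
  rewrite inE => /orP[/eqP->|]; first exact: J_bdd.
  exact: expand_bdd.
exists j, (fun n => [set g | g \in (st n).1]); split.
- apply: homo_ltn; first exact: ltn_trans.
  by move=> n; have [] := hnext (st n.+1, n.+1) (@st_bdd n.+1).
- split => [n|n x|n g|n g hg|n g e hg he|n g e hg he|n|n g hg|n g hg|n g hg].
  + exact: F_bdd.
  + exact: F_le1.
  + exact: st_bdd.
  + rewrite /= inE; apply/orP; right; apply/flatten_mapP; exists g => //.
    by rewrite mem_head.
  + rewrite /= inE; apply/orP; right; apply/flatten_mapP; exists g => //.
    by rewrite !inE; case: he => ->; rewrite eqxx ?orbT.
  + rewrite /= inE; apply/orP; right; apply/flatten_mapP; exists g => //.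
    by rewrite !inE; case: he => ->; rewrite eqxx ?orbT.
  + exact: ltW.
  + by have [_ /(_ g hg)[]] := hnext (st n, n) (@st_bdd n).
  + by have [_ /(_ g hg)[]] := hnext (st n, n) (@st_bdd n).
  + by have [_ /(_ g hg)[]] := hnext (st n, n) (@st_bdd n).
- by rewrite /= mem_head.
- by case=> [|n]; rewrite /= !inE eqxx ?orbT.
Qed.

End selection.

(** * Lebesgue measure and the Rademacher functions *)

Section lebesgue.
Variable R : realType.

Lemma Leb_measurable (A : set R) : measurable A -> measurable (A : set (Leb R)).
Proof. exact: sub_caratheodory. Qed.

Lemma leb_itv (i : interval R) :
  leb ([set` i] : set (Leb R)) = (if ((i.1 : \bar R) < i.2)%E then (i.2 : \bar R) - i.1 else 0)%E.
Proof. exact: (@lebesgue_measure_itv R i). Qed.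

Lemma measurable_seg (a b : R) : measurable (seg a b).
Proof. exact: (Leb_measurable (measurable_itv `[a, b]%R)). Qed.

Lemma leb_seg (a b : R) : a < b -> leb (seg a b) = (b - a)%:E.
Proof. by move=> ab; rewrite leb_itv /= lte_fin ab. Qed.

Lemma leb_set1 (x : R) : leb ([set x] : set (Leb R)) = 0%E.
Proof. exact: (@lebesgue_measure_set1 R x). Qed.

Lemma leb_setU (A B : set (Leb R)) : measurable A -> measurable B ->
  A `&` B = set0 -> leb (A `|` B) = (leb A + leb B)%E.
Proof. exact: (measureU (@completed_lebesgue_measure R)). Qed.

(** Disposes of division points and endpoints inside an event [A] whose measurability is still to be
    shown. *)
Lemma measurable_leb_point (A : set (Leb R)) (x : R) :
  measurable (A `&` [set (x : Leb R)]) /\ leb (A `&` [set (x : Leb R)]) = 0%E.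
Proof.
have mx : measurable ([set x] : set (Leb R)) by exact: (Leb_measurable (measurable_set1 x)).
have [Ax|nAx] := pselect (A x).
  rewrite (_ : A `&` _ = [set x]); first by split=> //; exact: leb_set1.
  by apply/seteqP; split => y /= => [[]|->].
rewrite (_ : A `&` _ = set0) ?measure0 //.
by apply/seteqP; split => y //= -[Ay yx]; apply: nAx; rewrite -yx.
Qed.

Lemma sinD2kpi (y : R) k : sin (y + (2 * k)%:R * pi) = sin y.
Proof.
elim: k => [|k IH]; first by rewrite muln0 mul0r addr0.
rewrite (_ : y + _ = y + (2 * k)%:R * pi + pi *+ 2) ?sinD2pi //.
by rewrite mulnS natrD; ring.
Qed.

(** Here [2 ^+ j * pi * x] lies strictly between [k * pi] and [(k + 1) * pi], where the sine has
    sign [(-1) ^+ k]. The index is [j.+1] because [rademacher] has exponent [n.-1]. *)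
Lemma rademacher_dyadic j k (x : R) :
  k%:R / 2 ^+ j < x < k.+1%:R / 2 ^+ j -> rademacher R j.+1 x = (-1) ^+ k.
Proof.
have h2 : 0 < 2 ^+ j :> R by rewrite exprn_gt0.
rewrite ltr_pdivrMr // ltr_pdivlMr // => /andP[h3 h4]; rewrite /rademacher /=.
have -> : 2 ^+ j * pi * x = (2 ^+ j * x - k%:R) * pi + k%:R * pi by ring.
set y := 2 ^+ j * x - k%:R.
have hy : 0 < y * pi < pi.
  have p0 := pi_gt0 R; apply/andP; split; first by apply: mulr_gt0 => //; rewrite /y; lra.
  by rewrite -[X in _ < X]mul1r ltr_pM2r //; move: h4; rewrite -natr1 /y; lra.
have hs := sin_gt0_pi hy; clearbody y.
rewrite -(odd_double_half k) -mul2n natrD mulrDl addrA sinD2kpi exprD exprM sqrrN expr1n.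
rewrite expr1n mulr1; case: (odd k) => /=.
  by rewrite mul1r sinDpi sgrN gtr0_sg // expr1.
by rewrite mul0r addr0 gtr0_sg.
Qed.

Definition dyadic j k : set (Leb R) := (`]k%:R / 2 ^+ j, k.+1%:R / 2 ^+ j[ : set R).

Lemma leb_dyadic j k : leb (dyadic j k) = (2^-1 ^+ j)%:E.
Proof.
have h2 : 0 < 2 ^+ j :> R by rewrite exprn_gt0.
rewrite leb_itv /= lte_fin ltr_pM2r ?invr_gt0 // ltr_nat ltnSn.
by rewrite -EFinB -mulrBl -natr1 addrAC subrr add0r mul1r exprVn.
Qed.

Lemma dyadic_split j k : dyadic j k =
  dyadic j.+1 (2 * k) `|` (dyadic j.+1 (2 * k).+1 `|`
    [set ((2 * k).+1%:R / 2 ^+ j.+1 : Leb R)]).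
Proof.
have h2 : 0 < 2 ^+ j :> R by rewrite exprn_gt0.
have e0 : k%:R / 2 ^+ j = (2 * k)%:R / 2 ^+ j.+1 :> R.
  by rewrite exprS natrM; field; rewrite gt_eqF.
have e1 : k.+1%:R / 2 ^+ j = (2 * k).+2%:R / 2 ^+ j.+1 :> R.
  by rewrite exprS -!natr1 natrM; field; rewrite gt_eqF.
have h3 : 0 < (2 ^+ j.+1)^-1 :> R by rewrite invr_gt0 exprn_gt0.
have l0 : (2 * k)%:R / 2 ^+ j.+1 < (2 * k).+1%:R / 2 ^+ j.+1 :> R.
  by rewrite ltr_pM2r // ltr_nat.
have l1 : (2 * k).+1%:R / 2 ^+ j.+1 < (2 * k).+2%:R / 2 ^+ j.+1 :> R.
  by rewrite ltr_pM2r // ltr_nat.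
rewrite /dyadic e0 e1; apply/seteqP; split => x /=; rewrite !in_itv /=.
  move=> /andP[h h']; case: (ltgtP x ((2 * k).+1%:R / 2 ^+ j.+1)) => hx.
  - by left; rewrite h.
  - by right; left; rewrite h'.
  - by right; right.
move=> [/andP[h h']|[/andP[h h']|->]].
- by rewrite h (lt_trans h').
- by rewrite h' (lt_trans l0).
- by rewrite l0 l1.
Qed.

(** Halving a dyadic interval fixes the next Rademacher function to be 1 on the left half and -1 on
    the right, which reproduces the recursion [tailS]. The index [j.+2] is the first whose function
    is not constant on open intervals of level [j]. *)
Lemma leb_rademacher_dyadic m j k (a : nat -> R) (b z : R) :
  let E := dyadic j k `&`
    [set x | z < `|b + \sum_(i < m) a i * rademacher R (j + i).+2 x|] in
  measurable E /\ leb E = (2^-1 ^+ j * tail m a b z)%:E.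
Proof.
elim: m j k a b => [|m IH] j k a b /=.
  have -> : [set x | z < `|b + \sum_(i < 0) a i * rademacher R (j + i).+2 x|] =
      [set x : Leb R | z < `|b|].
    by apply/seteqP; split => x /=; rewrite big_ord0 addr0.
  rewrite tail0; case: (ltP z `|b|) => h.
    rewrite (_ : [set x | _] = setT) ?setIT; last by apply/seteqP; split.
    by rewrite mulr1 leb_dyadic; split => //; exact: (Leb_measurable (measurable_itv _)).
  rewrite (_ : [set x | _] = set0) ?setI0; last first.
    by apply/seteqP; split => x //=; rewrite ltNge h.
  by rewrite mulr0; split => //; exact: measure0.
set A := [set x | _].
have half e k' : (-1) ^+ k' = e :> R ->
    measurable (dyadic j.+1 k' `&` A) /\
    leb (dyadic j.+1 k' `&` A) =
      (2^-1 ^+ j.+1 * tail m (fun i => a i.+1) (b + e * a 0%N) z)%:E.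
  move=> he; have := IH j.+1 k' (fun i => a i.+1) (b + e * a 0%N).
  rewrite (_ : _ `&` _ = dyadic j.+1 k' `&` A) //.
  have hx (x : R) : dyadic j.+1 k' x ->
      b + e * a 0%N + \sum_(i < m) a i.+1 * rademacher R (j.+1 + i).+2 x =
      b + \sum_(i < m.+1) a i * rademacher R (j + i).+2 x.
    rewrite /dyadic /= in_itv /= => /rademacher_dyadic hr.
    rewrite big_ord_recl /= addn0 hr he addrA [a 0%N * _]mulrC; congr (_ + _).
    by apply: eq_bigr => i _; rewrite /bump /= add1n addnS addSn.
  by apply/seteqP; split => x /= [Dx]; rewrite /A /= -hx // => h; split => //; rewrite hx.
have [ml el] := half 1 (2 * k)%N (ltac:(by rewrite exprM sqrrN expr1n expr1n)).
have [mr er] := half (-1) (2 * k).+1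
  (ltac:(by rewrite exprS exprM sqrrN expr1n expr1n mulr1)).
have [mp ep] := measurable_leb_point A ((2 * k).+1%:R / 2 ^+ j.+1).
rewrite dyadic_split !setIUl [ [set _] `&` A]setIC.
have dis k1 k2 : (k1 < k2)%N -> dyadic j.+1 k1 `&` dyadic j.+1 k2 = set0.
  move=> k12; apply/seteqP; split => x //=; rewrite /dyadic /= !in_itv /= => -[].
  move=> /andP[_ h] /andP[h' _]; have := lt_trans h' h.
  by rewrite ltr_pM2r ?invr_gt0 ?exprn_gt0 // ltr_nat ltnS leqNgt k12.
have disp k1 k2 : (k1 = k2 \/ k1 = k2.+1) ->
    dyadic j.+1 k2 `&` [set (k1%:R / 2 ^+ j.+1 : Leb R)] = set0.
  move=> hk; apply/seteqP; split => x //=; rewrite /dyadic /= in_itv /= => -[/andP[h h'] e].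
  by move: h h'; rewrite e => h h'; case: hk h h' => ->; rewrite ltxx.
split; first by do 2 apply: measurableU => //.
rewrite leb_setU //; [|by apply: measurableU|]; last first.
  apply/seteqP; split => x //= -[[xl _] [[xr _]|[_ xp]]].
    have xlr : (dyadic j.+1 (2 * k)%N `&` dyadic j.+1 (2 * k).+1) x by [].
    by rewrite dis in xlr.
  have xlp : (dyadic j.+1 (2 * k)%N `&` [set ((2 * k).+1%:R / 2 ^+ j.+1 : Leb R)]) x by [].
  by rewrite disp in xlp; last by right.
rewrite leb_setU //; last first.
  apply/seteqP; split => x //= -[[xr _] [_ xp]].
  have xrp : (dyadic j.+1 (2 * k).+1 `&` [set ((2 * k).+1%:R / 2 ^+ j.+1 : Leb R)]) x by [].
  by rewrite disp in xrp; last by left.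
rewrite [leb (dyadic _ _ `&` A)]el [leb (dyadic _ (2 * k).+1 `&` A)]er.
rewrite [leb (A `&` _)]ep adde0 -EFinD tailS exprS; congr (_%:E).
by rewrite mul1r mulN1r; field.
Qed.

(* [r_1] is the constant 1 inside [0, 1], not a random sign; as the other signs
   are symmetric, this does not affect the absolute value of the sum. *)
Lemma leb_rademacher m (a : nat -> R) (z : R) : 0 < z ->
  leb (I01 R `&` [set x | z < `|\sum_(i < m) a i * rademacher R i.+1 x|]) =
  (tail m a 0 z)%:E.
Proof.
move=> z0; case: m => [|m].
  rewrite tail0 normr0 ltNge (ltW z0) /= (_ : I01 R `&` _ = set0); first exact: measure0.
  by apply/seteqP; split => x //= -[_]; rewrite big_ord0 normr0 ltNge (ltW z0).
set A := [set x | _].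
have -> : tail m.+1 a 0 z = tail m (fun i => a i.+1) (a 0%N) z.
  by rewrite tailS sub0r tailN add0r; field.
have := leb_rademacher_dyadic m 0 0 (fun i => a i.+1) (a 0%N) z; rewrite mul1r.
set E := dyadic _ _ `&` _ => -[mE <-].
have EA : E = dyadic 0 0 `&` A.
  have hx (x : R) : dyadic 0 0 x ->
      a 0%N + \sum_(i < m) a i.+1 * rademacher R (0 + i).+2 x =
      \sum_(i < m.+1) a i * rademacher R i.+1 x.
    rewrite /dyadic /= in_itv /= => /rademacher_dyadic hr.
    by rewrite big_ord_recl /= hr expr0 mulr1.
  by apply/seteqP; split => x /= [Dx]; rewrite /A /= -hx // => h; split => //; rewrite hx.
have -> : I01 R `&` A = E `|` ((A `&` [set (0 : R)]) `|` (A `&` [set (1 : R)])).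
  rewrite EA; apply/seteqP; split => x /=.
    rewrite /dyadic /I01 /seg /= !in_itv /= expr0 !divr1 => -[/andP[h0 h1] Ax].
    move: h0; rewrite le_eqVlt => /orP[/eqP h0|h0]; first by right; left; split.
    move: h1; rewrite le_eqVlt => /orP[/eqP h1|h1]; first by right; right; split.
    by left; rewrite h0.
  rewrite /dyadic /I01 /seg /= !in_itv /= expr0 !divr1.
  move=> [[/andP[h0 h1] Ax]|[[Ax e]|[Ax e]]].
  - by split => //; rewrite !ltW.
  - by split => //; rewrite e lexx ler01.
  - by split => //; rewrite e lexx ler01.
have [m0 e0] := measurable_leb_point A 0.
have [m1 e1] := measurable_leb_point A 1.
rewrite EA in mE *.
rewrite leb_setU //; [|by apply: measurableU|]; last first.
  apply/seteqP; split => x //=; rewrite /dyadic /= in_itv /= expr0 !divr1.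
  by move=> [[/andP[h0 h1] _] [[_ e]|[_ e]]]; move: h0 h1; rewrite e ltxx.
rewrite leb_setU //; last first.
  apply/seteqP; split => x //= -[[_ ->] [_ /eqP]].
  by rewrite eq_sym oner_eq0.
by rewrite [leb (A `&` [set 0])]e0 [leb (A `&` [set 1])]e1 !adde0.
Qed.

End lebesgue.

(** * Equivalence in distribution *)

Lemma limn_einf_gt0 (R : realType) (u : nat -> \bar R) : (0 < limn_einf u)%E ->
  exists2 c : R, 0 < c & \forall k \near \oo, (c%:E <= u k)%E.
Proof.
rewrite limn_einf_lim (cvg_lim _ (@cvg_einfs_sup _ u)) //.
move=> /ereal_sup_gt[_ [n _ <-] hn].
have hk k : (n <= k)%N -> (einfs u n <= u k)%E.
  by move=> nk; apply: ereal_inf_lbound; exists k.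
move: hn hk; case: (einfs u n) => [c| |//] hc hk.
  by exists c; [rewrite -lte_fin | exists n].
by exists 1 => //; exists n => // k /hk; apply: le_trans; rewrite leey.
Qed.

(** A mesh [1 / q.+1] below half the length of the segment leaves room for a whole cell, and all
    such cells form a countable family. *)
Lemma dense_fractions (R : realType) (a b : R) : 0 <= a -> a < b ->
  exists p q : nat, a <= p%:R / q.+1%:R /\ p.+1%:R / q.+1%:R <= b.
Proof.
move=> a0 ab; pose q := Num.bound (2 / (b - a)).
have ba : 0 < b - a by rewrite subr_gt0.
have hq : 2 < q.+1%:R * (b - a).
  have := @archi_boundP _ (2 / (b - a)); rewrite divr_ge0 ?(ltW ba) // => /(_ isT).
  by rewrite ltr_pdivrMr // -/q -natr1; lra.
have q0 : 0 < q.+1%:R :> R by rewrite ltr0n.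
have hp : 0 <= a * q.+1%:R by rewrite mulr_ge0 // ltW.
have /andP[h1 h2] := truncn_itv hp.
exists (Num.truncn (a * q.+1%:R)).+1, q.
rewrite ler_pdivlMr // ler_pdivrMr //; split; first exact: ltW.
by rewrite -natr1 -natr1; lra.
Qed.

Section subsequence.
Variable R : realType.
Local Notation I01 := (I01 R).
Local Notation leb := (@leb R).

Lemma measurable_I01 : measurable I01.
Proof. exact: measurable_seg. Qed.

Lemma leb_I01 : leb I01 = 1%E.
Proof. by rewrite leb_seg ?ltr01 // subr0. Qed.

Lemma leb_gt (u : Leb R -> R) t : bdd I01 u ->
  leb (I01 `&` [set x | t < `|u x|]) = (mean leb I01 (fun x => (t < `|u x|)%R%:R))%:E.
Proof. exact: (mean_gt measurable_I01 leb_I01). Qed.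

(** [g] stands for the indicator of a rational segment inside [seg a b]. The lower estimate passes
    from [g] to [seg a b] by [g <= \1_(seg a b)], the upper one from [I01] by
    [\1_(seg a b) <= 1]. *)
Lemma equiv_lacunary (f : nat -> Leb R -> R) (D c : R) (a b : R) (g : Leb R -> R)
    (L : (Leb R -> R) -> R) (G : nat -> set (Leb R -> R)) (eta : nat -> R) (kappa : R) :
  0 <= a -> b <= 1 -> 1 <= D ->
  (forall u v, bdd I01 u -> bdd I01 v -> L (fun x => u x + v x) = L u + L v) ->
  (forall t u, bdd I01 u -> L (fun x => t * u x) = t * L u) ->
  lacunary leb I01 L (fun n x => D^-1 * f n x) G eta ->
  (forall n, \sum_(i < n) (2 * i + 3)%:R * eta i <= kappa) ->
  kappa <= 1 -> G 0%N (fun=> 1) -> G 0%N g ->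
  (forall x, I01 x -> 0 <= g x <= \1_(seg a b) x) -> L g = c -> 0 < c -> 6 * kappa <= c ->
  equiv_distr (fun i x => f i x * \1_(seg a b) x) (fun i => rademacher R i.+1).
Proof.
move=> a0 b1 D1 LD LZ lac hk k1 G1 Gg g01 Lg c0 kc.
have D0 : 0 < D by apply: lt_le_trans D1.
pose psi n (x : Leb R) := D^-1 * f n x.
have [r hr] : exists r : nat, 64 <= c * 2 ^+ r.
  exists (Num.bound (64 / c)); have h0 : 0 <= 64 / c by rewrite divr_ge0 // ltW.
  have := archi_boundP h0; rewrite ltr_pdivrMr // mulrC => /ltW/le_trans; apply.
  by rewrite ler_pM2l // -natrX ler_nat ltnW // ltn_expl.
have r0 : 0 < 2 ^+ r :> R by rewrite exprn_gt0.
have r1 : 1 <= 2 ^+ r :> R by rewrite exprn_ege1 // ler1n.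
have rc : 0 < 128 * 2 ^+ r / c by rewrite divr_gt0 // mulr_gt0.
(* 16 is the factor of [upper_tail], [2 * D] converts its level to the scale of [f], and
   [128 * 2 ^+ r / c] is the factor of [lower_tail]. *)
have [C [C16 CD Cr]] : exists C : R, [/\ 16 <= C, 2 * D <= C & 128 * 2 ^+ r / c <= C].
  exists (16 + 2 * D + 128 * 2 ^+ r / c); move: rc; set t := _ / c => t0.
  by split; lra.
have C0 : 0 < C by lra.
have g01' x : I01 x -> 0 <= g x <= 1.
  move=> /g01/andP[-> h]; apply: le_trans h _; rewrite indicE; by case: (_ \in _).
have bS al m : bdd I01 (psum psi al m) := psum_bdd lac al m.
have bF (al : nat -> R) m : bdd I01 (fun x => \sum_(i < m) al i * (f i x * \1_(seg a b) x)).
  apply: (bdd_sum (u := fun i x => al i * (f i x * \1_(seg a b) x))) => i _.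
  apply: bddZ; apply: bddM; last by apply: bdd_indic; exact: measurable_seg.
  have := bddZ D (lac_bdd lac i); rewrite (_ : (fun x => _) = f i) //.
  by apply/funext => x; rewrite mulrA divff ?mul1r // gt_eqF.
have FE (al : nat -> R) m (x : Leb R) : \sum_(i < m) al i * (f i x * \1_(seg a b) x) =
    D * psum psi al m x * \1_(seg a b) x.
  rewrite /psum mulr_sumr mulr_suml; apply: eq_bigr => i _.
  by rewrite /psi; field; rewrite gt_eqF.
exists C; split=> // m al z z0.
rewrite leb_rademacher //.
split.
- rewrite (leb_gt (C * z) (bF al m)) -EFinM lee_fin.
  rewrite ler_pdivrMl //.
  (* In units of [psi] the level [C * z] is [2 * w], and [2 * D <= C] gives [z <= w]. *)
  pose w := C * z / (2 * D).
  have w0 : 0 < w by rewrite divr_gt0 ?mulr_gt0.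
  apply: (@le_trans _ _ (mean leb I01 (fun x => (2 * w < `|psum psi al m x|)%R%:R))).
    apply: (le_mean measurable_I01 leb_I01).
    + by apply: bdd_gt => //; exact: measurable_I01.
    + by apply: bdd_gt => //; exact: measurable_I01.
    move=> x _; rewrite ler_nat; case: (ltP (C * z)) => // h.
    rewrite lt0b; move: h; rewrite FE indicE; case: (_ \in _); last first.
      by rewrite mulr0 normr0 ltNge mulr_ge0 // ltW.
    rewrite mulr1 normrM (gtr0_norm D0) => h.
    have -> : 2 * w = C * z / D by rewrite /w; field; rewrite gt_eqF.
    by rewrite ltr_pdivrMr // [X in _ < X]mulrC.
  apply: le_trans (upper_tail measurable_I01 leb_I01 lac hk k1 G1 al m w0) _.
  have : tail m al 0 w <= tail m al 0 z.
    apply: le_tail; by rewrite /w ler_pdivlMr ?mulr_gt0 // mulrC ler_pM2r.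
  have : 16 * tail m al 0 z <= C * tail m al 0 z.
    by apply: ler_wpM2r; first exact: tail_ge0.
  by move=> h1 h2; apply: le_trans h1; rewrite ler_pM2l.
- rewrite (leb_gt (C^-1 * z) (bF al m)) -EFinM lee_fin.
  pose w := c * z / 16.
  have w0 : 0 < w by rewrite divr_gt0 // mulr_gt0.
  have := lower_tail measurable_I01 leb_I01 LD LZ lac hk k1 G1 al m Gg g01' Lg c0 kc w0 hr.
  have -> : 16 / c * w = z by rewrite /w; field; rewrite gt_eqF.
  set q := mean _ _ _; set q' := mean _ _ _ => hq.
  have qq' : q <= q'.
    apply: (le_mean measurable_I01 leb_I01).
    + apply: bddM; last exact: (lac_Gbdd lac Gg).
      by apply: bdd_gt => //; exact: measurable_I01.
    + by apply: bdd_gt => //; exact: measurable_I01.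
    move=> x Ix; have /andP[g0 g1] := g01 x Ix.
    case: (ltP w) => h; last by rewrite mul0r ler0n.
    rewrite mul1r; apply: le_trans g1 _.
    rewrite FE indicE; case: (_ \in _); last by rewrite ler0n.
    rewrite mulr1 normrM (gtr0_norm D0) ler_nat lt0b.
    apply: (@le_lt_trans _ _ w); last by rewrite (lt_le_trans h) // ler_peMl.
    (* [C] dominates the factor of [lower_tail], hence also [16 / c], which makes [C^-1 * z] at most
       [w]. *)
    have h16 : 16 <= C * c.
      move: Cr; rewrite ler_pdivrMr // => h16; apply: le_trans h16.
      by rewrite -[leLHS]mulr1; apply: ler_pM => //; lra.
    rewrite ler_pdivrMl // /w (_ : C * _ = C * c * z / 16); last by ring.
    by rewrite ler_pdivlMr // mulrC ler_pM2r.
  have : 0 <= q by apply: mean_ge0 => x /g01'/andP[? _]; rewrite mulr_ge0.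
  move=> q0; have : tail m al 0 z <= 128 * 2 ^+ r / c * q.
    by rewrite mulrAC ler_pdivlMr // mulrC.
  move=> /le_trans; apply; apply: ler_pM => //; exact: ltW.
Qed.

(** Numbers that code no pair fall back to [(0, 0)], which gives the segment [[0, 1]]. *)
Definition segment_of (n : nat) : R * R :=
  let: (p, q) := odflt (0%N, 0%N) (unpickle n) in (p%:R / q.+1%:R, p.+1%:R / q.+1%:R).

(** The divisor cancels the weight [2 * n + 3] of [moment_riesz] and leaves a geometric series,
    whose sum from [k] on is [2 * 2^-1 ^+ k]. *)
Definition gap (n : nat) : R := 2^-1 ^+ n / (2 * n + 3)%:R.

Lemma gap_gt0 n : 0 < gap n.
Proof. by rewrite divr_gt0 ?exprn_gt0 ?invr_gt0 // ltr0n addnS. Qed.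

Lemma gap_sum k n : \sum_(i < n) (2 * i + 3)%:R * gap (k + i) <= 2 * 2^-1 ^+ k.
Proof.
have e0 (m : nat) : 0 < 2^-1 ^+ m :> R by rewrite exprn_gt0 // invr_gt0.
have term (i : nat) : (2 * i + 3)%:R * gap (k + i) <= 2^-1 ^+ k * 2^-1 ^+ i.
  rewrite /gap exprD mulrCA; apply: ler_piMr.
    by apply: mulr_ge0; exact: ltW.
  rewrite ler_pdivrMr; last by rewrite ltr0n addnS.
  by rewrite mul1r ler_nat leq_add2r leq_pmul2l // leq_addl.
apply: le_trans (ler_sum _ (fun (i : 'I_n) _ => term i)) _.
rewrite -mulr_sumr mulrC ler_pM2r //.
suff -> : \sum_(i < n) 2^-1 ^+ i = 2 - 2 * 2^-1 ^+ n :> R by have := e0 n; lra.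
elim: n => [|n IH]; first by rewrite big_ord0; ring.
by rewrite big_ord_recr /= IH exprS; field.
Qed.

Lemma equiv_distr_subseq (f : nat -> Leb R -> R) (nk : nat -> nat) (D : R) :
  (forall n, measurable_fun I01 (f n)) ->
  {homo nk : i j / (i < j)%N} ->
  (forall k x, I01 x -> `| f (nk k) x | <= D) ->
  weakL2_to0 (fun k => f (nk k)) ->
  (forall a b : R, 0 <= a -> a < b -> b <= 1 ->
    (0 < limn_einf (fun k => \int[leb]_(x in seg a b) ((f (nk k) x) ^+ 2)%:E))%E) ->
  exists phi : nat -> nat, {homo phi : i j / (i < j)%N} /\
    forall a b : R, 0 <= a -> a < b -> b <= 1 -> exists k0 : nat,
      equiv_distr (fun i x => f (phi (k0 + i)%N) x * \1_(seg a b) x)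
                  (fun i => rademacher R i.+1).
Proof.
move=> mf nk_mono fD f_weak f_inf; pose E := `|D| + 1.
have E1 : 1 <= E by rewrite /E lerDr.
have E0 : 0 < E by apply: lt_le_trans E1.
have bf k : bdd I01 (f (nk k)) by split => //; exists D => x; apply: fD.
pose F k (x : Leb R) := E^-1 * f (nk k) x.
have F_bdd k : bdd I01 (F k) by apply: bddZ.
have F_le1 k x : I01 x -> `|F k x| <= 1.
  move=> Ix; rewrite normrM gtr0_norm ?invr_gt0 // ler_pdivrMl // mulr1.
  by apply: le_trans (fD k x Ix) (le_trans (ler_norm _) _); rewrite /E lerDl.
have F_weak u : bdd I01 u ->
    mean leb I01 (fun x => F k x * u x) @[k --> \oo] --> (0 : R).
  move=> hu; rewrite -(mulr0 E^-1).
  rewrite (_ : (fun k => _) = fun k => E^-1 * Rintegral leb I01 (fun x => f (nk k) x * u x)).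
    apply: cvgMr; apply: f_weak; first by case: hu.
    exact: (integrable_lty measurable_I01 (bdd_integrable measurable_I01 leb_I01 (bddX 2 hu))).
  apply/funext => k.
  rewrite -(meanZ measurable_I01 leb_I01 E^-1 (bddM (bf k) hu)).
  by apply: eq_mean => x _; rewrite mulrA.
(* An ultrafilter finer than the eventual filter is nonprincipal and preserves limits at
   infinity. *)
have [U [hU ooU]] := ultraFilterLemma (eventually_filter : ProperFilter \oo).
pose J n : Leb R -> R := \1_(seg (segment_of n).1 (segment_of n).2).
have J_bdd n : bdd I01 (J n) by apply: bdd_indic; exact: measurable_seg.
have [j [G [j_mono lac G1 GJ]]] :=
  lacunary_subseq measurable_I01 leb_I01 F_bdd F_le1 F_weak hU ooU J_bdd gap_gt0.
exists (fun n => nk (j n)); split; first by move=> m n mn; apply/nk_mono/j_mono.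
move=> a b a0 ab b1.
have [p [q [hp hq]]] := dense_fractions a0 ab.
pose n := pickle (p, q).
have seg_n : segment_of n = (p%:R / q.+1%:R, p.+1%:R / q.+1%:R).
  by rewrite /segment_of pickleK.
set a' := p%:R / q.+1%:R in hp seg_n; set b' := p.+1%:R / q.+1%:R in hq seg_n.
have a'0 : 0 <= a' := le_trans a0 hp; have b'1 : b' <= 1 := le_trans hq b1.
have ab' : a' < b' by rewrite /a' /b' ltr_pM2r ?invr_gt0 ?ltr0n // ltr_nat.
have segI : seg a' b' `<=` I01.
  move=> x; rewrite /seg /I01 /seg /= !in_itv /= => /andP[h1 h2].
  by rewrite (le_trans a'0) // (le_trans h2).
pose L := sqlim leb I01 F U; pose c := L (J n).
(* The lower limit over the rational segment is positive and passes to [sqlim] with the factor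
   [E^-1 ^+ 2]. *)
have c0 : 0 < c.
  have [t t0 ht] := limn_einf_gt0 (f_inf _ _ a'0 ab' b'1).
  apply: (@lt_le_trans _ _ (E^-1 ^+ 2 * t)).
    by rewrite mulr_gt0 // exprn_gt0 // invr_gt0.
  apply: (sqlim_ge measurable_I01 leb_I01 F_bdd F_le1 hU ooU (J_bdd n)).
  apply: filterS ht => k.
  rewrite -(mean_restrict measurable_I01 leb_I01 (measurable_seg _ _) segI
    (bddX 2 (bf k))).
  rewrite lee_fin => ht.
  have hJf : bdd I01 (fun x => \1_(seg a' b') x * f (nk k) x ^+ 2).
    by apply: bddM; [apply: bdd_indic; exact: measurable_seg | exact: bddX].
  rewrite (_ : mean _ _ _ = E^-1 ^+ 2 * mean leb I01 (fun x => \1_(seg a' b') x * f (nk k) x ^+ 2)).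
    by rewrite ler_pM2l // exprn_gt0 // invr_gt0.
  rewrite -(meanZ measurable_I01 leb_I01 _ hJf); apply: eq_mean => x _.
  by rewrite /J seg_n /F exprMn; ring.
(* [k] is at least [n], so that [J n] already belongs to [G k], and large enough for the total error
   [2 * 2^-1 ^+ k] to meet both bounds on [kappa]; 12 is [6 * 2]. *)
have [k [nk0 hk1 hkc]] : exists k : nat,
    [/\ (n <= k)%N, 2 * 2^-1 ^+ k <= 1 :> R & 6 * (2 * 2^-1 ^+ k) <= c].
  pose k := (n + (Num.bound (12 / c)).+1)%N; exists k; split; first exact: leq_addr.
    rewrite exprVn ler_pdivrMr ?exprn_gt0 // mul1r -{1}(expr1 (2 : R)).
    by rewrite ler_eXn2l ?ltr1n // /k addnS.
  rewrite mulrA exprVn ler_pdivrMr ?exprn_gt0 // -natrM mulrC -ler_pdivrMr //.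
  have h0 : 0 <= 12 / c by rewrite divr_ge0 // ltW.
  apply: le_trans (ltW (archi_boundP h0)) _; rewrite -natrX ler_nat.
  apply: leq_trans (ltnW (ltn_expl _ (ltnSn 1))) _; rewrite leq_exp2l //.
  by rewrite /k addnS ltnW // ltnS leq_addl.
have G_mono i g : G i g -> forall k', (i <= k')%N -> G k' g.
  move=> hg; elim=> [|k' IH]; first by rewrite leqn0 => /eqP <-.
  by rewrite leq_eqVlt => /orP[/eqP<- //|/IH]; apply: (lac_mono lac).
exists k; apply: (@equiv_lacunary (fun i => f (nk (j (k + i)%N))) E c a b (J n) L
  (fun i => G (k + i)%N) (fun i => gap (k + i)%N) (2 * 2^-1 ^+ k) a0 b1 E1).
- by move=> u v; exact: (sqlimD measurable_I01 leb_I01 F_bdd F_le1 hU).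
- by move=> t u; exact: (sqlimZ measurable_I01 leb_I01 F_bdd F_le1 hU).
- exact: (lacunary_shift k lac).
- by move=> m; exact: gap_sum.
- exact: hk1.
- by rewrite addn0; exact: (G_mono _ _ G1).
- by rewrite addn0; exact: (G_mono _ _ (GJ n)).
- move=> x _; rewrite /J seg_n !indicE ler0n ler_nat /=.
  case: (boolP (x \in seg a' b')) => //; rewrite !inE /seg /= !in_itv /=.
  by move=> /andP[h1 h2]; rewrite mem_set //= in_itv /= (le_trans hp) //= (le_trans h2).
- by [].
- exact: c0.
- exact: hkc.
Qed.

End subsequence.

Unset Implicit Arguments.
Set Strict Implicit.

Theorem theorem3p8 (R : realType) (f : nat -> Leb R -> R) :
  (forall n, measurable_fun (I01 R) (f n)) ->
  (exists (nk : nat -> nat) (D : R),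
      {homo nk : i j / (i < j)%N >-> (i < j)%N} /\
      (forall k x, I01 R x -> `| f (nk k) x | <= D) /\
      weakL2_to0 (fun k => f (nk k)) /\
      (forall F : set (Leb R), measurable F -> F `<=` I01 R ->
         (0 < leb F)%E ->
         (0 < limn_einf (fun k => \int[@leb R]_(x in F) ((f (nk k) x) ^+ 2)%:E))%E)) ->
  exists phi : nat -> nat,
    {homo phi : i j / (i < j)%N >-> (i < j)%N} /\
    forall a b : R, 0 <= a -> a < b -> b <= 1 ->
      exists k0 : nat,
        equiv_distr (fun i x => f (phi (k0 + i)%N) x * \1_(seg a b) x)
                    (fun i => rademacher R i.+1).
Proof.
move=> mf [nk [D [nk_mono [fD [f_weak f_inf]]]]].
apply: (equiv_distr_subseq mf nk_mono fD f_weak) => a b a0 ab b1.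
apply: f_inf; first exact: measurable_seg.
  move=> x; rewrite /I01 /seg /= !in_itv /= => /andP[h1 h2].
  by rewrite (le_trans a0) // (le_trans h2).
by rewrite leb_seg // lte_fin subr_gt0.
Qed.
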